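(* Let $G$ be a finite simple graph with at least three vertices that is isomorphic to $P_3(T)$ for some finite tree $T$. Then every finite simple graph $H$ having the same deck as $G$ is isomorphic to $G$; that is, the Reconstruction Conjecture holds for the class of graphs isomorphic to the cube of a tree.
   Context: For a graph $G$, its third power (cube) $P_3(G)$ is the graph on the same vertex set in which two distinct vertices are adjacent if and only if their distance in $G$ is at most $3$. A card of a finite graph $G$ is an unlabelled vertex-deleted subgraph $G-v$; the deck of $G$ is the multiset of (isomorphism classes of) all its cards, one for each vertex. The Reconstruction Conjecture asserts that every finite simple graph with at least three vertices is determined up to isomorphism by its deck. *)

(* Defs.v *)
From mathcomp Require Import all_boot.

Set Implicit Arguments.
Unset Strict Implicit.
Unset Printing Implicit Defensive.

Record sgraph := SGraph {
  vertex :> finType;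
  adj : rel vertex;
  adj_sym : symmetric adj;
  adj_irrefl : irreflexive adj }.

Section Iso.
Variables G H : sgraph.

Definition graph_iso : Prop :=
  exists2 f : G -> H, bijective f & forall x y, adj (f x) (f y) = adj x y.

(* With the inequality on cardinals, injectivity amounts to bijectivity. *)
Definition graph_isob : bool :=
  [exists f : {ffun G -> H},
     [&& injectiveb f, #|H| <= #|G| &
         [forall x, forall y, adj (f x) (f y) == adj x y]]].

Lemma graph_isobP : reflect graph_iso graph_isob.
Proof.
apply: (iffP existsP) => [[f /and3P[/injectiveP f_inj le_HG /forallP f_adj]]|].
  exists f; first exact: inj_card_bij.
  by move=> x y; apply/eqP; move/forallP: (f_adj x).
case=> f f_bij f_adj; exists (finfun f); apply/and3P; split.
- by apply/injectiveP => x y; rewrite !ffunE; apply: (bij_inj f_bij).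
- by rewrite (bij_eq_card f_bij).
- by apply/forallP => x; apply/forallP => y; rewrite !ffunE f_adj.
Qed.

End Iso.

Section Card.
Variables (G : sgraph) (v : G).

Definition card_adj : rel {x : G | x != v} := fun x y => adj (val x) (val y).

Lemma card_adj_sym : symmetric card_adj.
Proof. by move=> x y; apply: adj_sym. Qed.

Lemma card_adj_irrefl : irreflexive card_adj.
Proof. by move=> x; apply: adj_irrefl. Qed.

Definition vertex_deleted : sgraph := SGraph card_adj_sym card_adj_irrefl.

End Card.

(* A multiset of isomorphism classes is given by its multiplicity function:
   [deck G K] is the number of cards of [G] that are isomorphic to [K]. *)
Definition deck (G K : sgraph) : nat :=
  #|[set v : G | graph_isob (vertex_deleted v) K]|.

Definition same_deck (G H : sgraph) : Prop := forall K, deck G K = deck H K.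

Section Power.
Variable G : sgraph.

Definition has_walk (n : nat) (x y : G) : bool :=
  [exists p : n.-tuple G, path (@adj G) x p && (last x p == y)].

(* Length of a shortest walk from [x] to [y]; it is at most #|G| - 1 when there
   is one, and the junk value #|G| stands for an infinite distance. *)
Definition dist (x y : G) : nat :=
  find (fun n => has_walk n x y) (iota 0 #|G|).

Variable k : nat.

(* Connectedness is tested explicitly, as the junk value of [dist] may be at
   most [k]. *)
Definition power_adj : rel G :=
  fun x y => [&& x != y, connect (@adj G) x y & dist x y <= k].

Lemma has_walk_sym n x y : has_walk n x y = has_walk n y x.
Proof.
suff imp u v : has_walk n u v -> has_walk n v u by apply/idP/idP; apply: imp.
case/existsP=> p /andP[p_path /eqP <-].
have sz_p : size (rev (belast u p)) == n by rewrite size_rev size_belast size_tuple.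
apply/existsP; exists (Tuple sz_p); rewrite /= rev_path.
rewrite (eq_path (e' := @adj G)); last by move=> a b; apply: adj_sym.
rewrite p_path /=; case: (tval p) => [|a s] /=; first by rewrite eqxx.
by rewrite rev_cons last_rcons.
Qed.

Lemma power_adj_sym : symmetric power_adj.
Proof.
move=> x y; rewrite /power_adj eq_sym; congr [&& _, _ & _ <= _].
  exact: (sym_connect_sym (@adj_sym G)).
by apply: eq_find => n; apply: has_walk_sym.
Qed.

Lemma power_adj_irrefl : irreflexive power_adj.
Proof. by move=> x; rewrite /power_adj eqxx. Qed.

Definition graph_power : sgraph := SGraph power_adj_sym power_adj_irrefl.

End Power.

Definition connected_graph (G : sgraph) : Prop :=
  0 < #|G| /\ forall x y : G, connect (@adj G) x y.

(* [ucycle] accepts an edge traversed back and forth as a cycle of length 2. *)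
Definition acyclic (G : sgraph) : Prop :=
  forall c : seq G, ucycle (@adj G) c -> size c < 3.

Definition is_tree (G : sgraph) : Prop := connected_graph G /\ acyclic G.

(* Main.v *)
(* The cube of a tree is [d u v <= 3] for the path metric [d] of the tree. A
   graph with the deck of the cube can be drawn on the vertices of the tree so
   that it agrees with the cube off one vertex [x] of our choice; the task is to
   recover the neighbourhood of [x]. The degree of a vertex and the number of
   triangles through it can be read off its card, hence so can the fact that
   its neighbourhood is a clique (the vertex is simplicial).
   If some vertex is within distance 3 of all others, delete it. Otherwise let
   [l] be a simplicial vertex of minimal degree, and call level [i] the set of
   vertices at distance [i] from [l]; level 1 is a singleton.
   - If level 2 is not a singleton, [l] has a twin, which shows the
     neighbourhood of [x = l].
   - If levels 0 to 5 are singletons, let [x] be the vertex of level 1. Degrees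
     and triangles determine its neighbourhood up to exchanging the vertices of
     levels 4 and 5, and comparing sums of squares of degrees shows that these
     are twins off [x] whenever the exchange occurs.
   - Otherwise levels 0 to [k] are singletons and level [k + 1] is not, for some
     [k] in {2, 3, 4}. Let [x] and [b] be the vertices of levels [k - 1] and
     [k]. The card of another simplicial vertex [y] is the cube of a tree with
     a metric [d1], and [d <= 3] and [d1 <= 3] agree off [x]. Separators of the
     cube reveal that [b] has the same neighbours in both trees, [x] included,
     and then that the neighbourhood of [x] is the expected one. *)

Require Import Defs.
From mathcomp Require Import all_boot all_fingroup.
From mathcomp Require Import zify.

Set Implicit Arguments.
Unset Strict Implicit.
Unset Printing Implicit Defensive.

(* [lia] slows down badly on contexts with set memberships, which it parses. *)
Ltac dlia :=
  repeat match goal with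
  | H : ?T |- _ =>
    lazymatch T with
    | nat => fail
    | @eq nat _ _ => fail
    | ~ @eq nat _ _ => fail
    | is_true (leq _ _) => fail
    | is_true (~~ odd _) => fail
    | is_true (~~ (leq _ _)) => fail
    | _ \/ _ => fail
    | _ /\ _ => fail
    | _ => clear H
    end
  end; lia.

(* The path metric of a tree with vertex set [A]; the four-point condition and
   the parity of perimeters make the unit-distance graph a tree, so that no
   graph needs to be carried along. *)
Record tree_metric (V : finType) (A : {set V}) (d : V -> V -> nat) : Prop :=
  TreeMetric {
  tm_eq0 : {in A &, forall u v, (d u v == 0) = (u == v)};
  tm_sym : {in A &, forall u v, d u v = d v u};
  tm_step : {in A &, forall u v, u != v ->
     exists2 w, w \in A & d u w = 1 /\ d u v = (d w v).+1};
  tm_even : {in A & &, forall u v w, ~~ odd (d u v + d v w + d u w)};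
  tm_4pc : forall u v w z, u \in A -> v \in A -> w \in A -> z \in A ->
     d u v + d w z <= maxn (d u w + d v z) (d u z + d v w) }.

(** * Tree metrics *)

Section TreeMetricTheory.
Variables (V : finType) (A : {set V}) (d : V -> V -> nat).
Hypothesis dA : tree_metric A d.

Lemma tm_refl u : u \in A -> d u u = 0.
Proof. by move=> uA; apply/eqP; rewrite (tm_eq0 dA). Qed.

Lemma tm_gt0 u v : u \in A -> v \in A -> u != v -> 0 < d u v.
Proof. by move=> uA vA; rewrite lt0n (tm_eq0 dA). Qed.

Lemma tm_eq u v : u \in A -> v \in A -> d u v = 0 -> u = v.
Proof. by move=> uA vA /eqP; rewrite (tm_eq0 dA) // => /eqP. Qed.

Lemma tm_triangle w u v : w \in A -> u \in A -> v \in A ->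
  d u v <= d u w + d w v.
Proof.
move=> wA uA vA; have := tm_4pc dA uA vA wA wA.
by have := tm_refl wA; have := tm_sym dA vA wA; dlia.
Qed.

Lemma tm_nbr a b v : a \in A -> b \in A -> v \in A -> d a b = 1 ->
  d a v = (d b v).+1 \/ d b v = (d a v).+1.
Proof.
move=> aA bA vA ab; have := tm_triangle bA aA vA; have := tm_triangle aA bA vA.
by have := tm_even dA aA bA vA; have := tm_sym dA aA bA; dlia.
Qed.

Lemma tm_two_nbrs a b c v : a \in A -> b \in A -> c \in A -> v \in A ->
  d a b = 1 -> d a c = 1 -> b != c ->
  d b v = (d a v).+1 \/ d c v = (d a v).+1.
Proof.
move=> aA bA cA vA ab ac bc.
have := tm_gt0 bA cA bc; have := tm_even dA aA bA cA.
have := tm_triangle aA bA cA; have := tm_4pc dA bA cA aA vA.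
have := tm_nbr aA bA vA ab; have := tm_nbr aA cA vA ac.
by have := tm_sym dA aA bA; have := tm_sym dA aA cA; dlia.
Qed.

Lemma tm_split a b u v : a \in A -> b \in A -> u \in A -> v \in A ->
  d a b = 1 -> d a u = (d b u).+1 -> d b v = (d a v).+1 ->
  d u v = d a u + d a v.
Proof.
move=> aA bA uA vA ab au bv.
have := tm_4pc dA uA aA vA bA; have := tm_triangle aA uA vA.
have := tm_sym dA uA aA; have := tm_sym dA aA vA; have := tm_sym dA bA vA.
by have := tm_sym dA uA bA; have := tm_sym dA uA vA; dlia.
Qed.

Lemma tm_point u v k : u \in A -> v \in A -> k <= d u v ->
  exists2 w, w \in A & d u w = k /\ d u v = k + d w v.
Proof.
move=> uA vA; elim: k => [|k IHk] le_k; first by exists u; rewrite ?tm_refl.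
have [w wA [uw uv]] := IHk (ltnW le_k).
have nwv : w != v.
  by apply: contraTneq le_k => wv; move: uv; rewrite wv tm_refl //; dlia.
have [z zA [wz wv]] := tm_step dA wA vA nwv.
exists z => //; have := tm_triangle wA uA zA; have := tm_triangle zA uA vA; dlia.
Qed.

Lemma tm_uniq u v w z : u \in A -> v \in A -> w \in A -> z \in A ->
  d u w = d u z -> d u v = d u w + d w v -> d u v = d u z + d z v -> w = z.
Proof.
move=> uA vA wA zA uw uv uv'; apply: tm_eq => //.
have := tm_4pc dA uA vA wA zA.
by have := tm_sym dA vA wA; have := tm_sym dA vA zA; dlia.
Qed.

(* A set [D] separating [p] from [q] in the cube contains a closed
   neighbourhood of the tree: otherwise the vertices [g] of the path from [p]
   to [q] have neighbours outside [D], and two consecutive ones are at distance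
   at most 3. *)
Lemma tm_separator (D chi : pred V) p q :
  p \in A -> q \in A -> ~~ D p -> ~~ D q -> chi p != chi q ->
  {in A &, forall u v, ~~ D u -> ~~ D v -> d u v <= 3 -> chi u = chi v} ->
  exists2 w, w \in A & [/\ d p q = d p w + d w q, 1 < d p w, 1 < d w q &
     {in A, forall v, d w v <= 1 -> D v}].
Proof.
move=> pA qA Dp Dq chi_pq chiP.
have [/existsP[w /and3P[wA /eqP pwq /forallP wD]]|/existsPn noW] :=
  boolP [exists w, [&& w \in A, d p q == d p w + d w q &
     [forall v, (v \in A) ==> (d w v <= 1) ==> D v]]].
  have wD' v : v \in A -> d w v <= 1 -> D v.
    by move=> vA wv; have := wD v; rewrite vA wv.
  exists w => //; split=> //.
    by rewrite ltnNge; apply: contraNN Dp => wp; apply: wD'; rewrite // (tm_sym dA).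
  by rewrite ltnNge; apply: contraNN Dq => wq; apply: wD'.
case/negP: chi_pq; apply/eqP.
suff reach k w s : k <= d p q -> w \in A -> s \in A -> d p w = k ->
    d p q = k + d w q -> ~~ D s -> d w s <= 1 -> chi s = chi p.
  symmetry; apply: (@reach (d p q) q) => //; rewrite tm_refl //; dlia.
elim: k w s => [|k IHk] w s le_k wA sA pw pwq Ds ws.
  by apply: chiP => //; have := tm_triangle wA sA pA; have := tm_sym dA wA sA;
    have := tm_sym dA wA pA; dlia.
have k_le : k <= d p w by dlia.
have [g gA [pg gw]] := tm_point pA wA k_le.
have := noW g; rewrite gA /=; have -> /= : d p q == d p g + d g q.
  have := tm_triangle wA gA qA; have := tm_triangle gA pA qA; dlia.
case/forallPn => e; rewrite !negb_imply => /and3P[eA ge De].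
rewrite (chiP s e) //; first by apply: (IHk g) => //;
  have := tm_triangle wA gA qA; have := tm_triangle gA pA qA; dlia.
have := tm_triangle wA sA eA; have := tm_triangle gA wA eA.
by have := tm_sym dA wA sA; have := tm_sym dA gA wA; dlia.
Qed.

End TreeMetricTheory.

(** * The path metric of a tree *)

Section AddLeaf.
Variables (V : finType) (A : {set V}) (d : V -> V -> nat) (u v : V).

Definition leaf_metric (a b : V) : nat :=
  if a == v then if b == v then 0 else (d u b).+1
  else if b == v then (d a u).+1 else d a b.

Hypotheses (dA : tree_metric A d) (uA : u \in A) (vA : v \notin A).

Lemma leaf_metricE a b : a \in A -> b \in A -> leaf_metric a b = d a b.
Proof.
by move=> aA bA; rewrite /leaf_metric !ifN //; apply: contraNneq vA => <-.
Qed.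

Lemma leaf_metric_new b : b \in A -> leaf_metric v b = (d u b).+1.
Proof.
by move=> bA; rewrite /leaf_metric eqxx ifN //; apply: contraNneq vA => <-.
Qed.

Lemma leaf_metric_newr b : b \in A -> leaf_metric b v = (d u b).+1.
Proof.
move=> bA; rewrite /leaf_metric eqxx ifN 1?(tm_sym dA) //.
by apply: contraNneq vA => <-.
Qed.

Lemma leaf_metric_newnew : leaf_metric v v = 0.
Proof. by rewrite /leaf_metric eqxx. Qed.

Let leafE := (leaf_metric_newnew, leaf_metric_newr, leaf_metric_new, leaf_metricE).

Lemma tree_metric_add_leaf : tree_metric (v |: A) leaf_metric.
Proof.
split.
- move=> a b /setU1P[->|aA] /setU1P[->|bA]; rewrite ?leafE ?eqxx //.
  + by symmetry; apply: contraNF vA => /eqP->.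
  + by symmetry; apply: contraNF vA => /eqP<-.
  + exact: tm_eq0 dA _ _ aA bA.
- move=> a b /setU1P[->|aA] /setU1P[->|bA]; rewrite ?leafE //.
  exact: tm_sym dA _ _ aA bA.
- move=> a b /setU1P[->|aA] /setU1P[->|bA]; rewrite ?eqxx // => ab.
  + by exists u; rewrite ?setU1r // ?leafE ?(tm_refl dA).
  + have [au|au] := eqVneq a u.
      by exists v; rewrite ?setU11 // !leafE // au (tm_refl dA).
    have [w wA [aw awu]] := tm_step dA aA uA au.
    exists w; rewrite ?setU1r // ?leafE //.
    have := tm_sym dA aA uA; have := tm_sym dA wA uA; split; lia.
  + have [w wA waw] := tm_step dA aA bA ab.
    by exists w; rewrite ?setU1r // !leafE.
- move=> a b c /setU1P[->|aA] /setU1P[->|bA] /setU1P[->|cA]; rewrite ?leafE //;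
  try have := tm_even dA aA bA cA;
  try have := tm_even dA aA bA uA;
  try have := tm_even dA aA uA cA;
  try have := tm_even dA uA bA cA;
  try have := tm_sym dA aA uA;
  try have := tm_sym dA bA uA;
  try have := tm_sym dA cA uA;
  clear; lia.
- move=> a b c e /setU1P[->|aA] /setU1P[->|bA] /setU1P[->|cA] /setU1P[->|eA];
  rewrite ?leafE //;
  try have := tm_4pc dA aA bA cA eA;
  try have := tm_4pc dA uA bA cA eA;
  try have := tm_4pc dA aA uA cA eA;
  try have := tm_4pc dA aA bA uA eA;
  try have := tm_4pc dA aA bA cA uA;
  try have := tm_triangle dA uA aA bA;
  try have := tm_triangle dA uA aA cA;
  try have := tm_triangle dA uA aA eA;
  try have := tm_triangle dA uA bA cA;
  try have := tm_triangle dA uA bA eA;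
  try have := tm_triangle dA uA cA eA;
  try have := tm_sym dA aA uA;
  try have := tm_sym dA bA uA;
  try have := tm_sym dA cA uA;
  try have := tm_sym dA eA uA;
  clear; lia.
Qed.

End AddLeaf.

Section TreeToMetric.
Variable T : sgraph.

Lemma crossing_edge (A : {set T}) a b : connect (@adj T) a b ->
  a \in A -> b \notin A -> exists u v, [/\ u \in A, v \notin A & adj u v].
Proof.
case/connectP=> p; elim: p a => [|c p IHp] a /=; first by move=> _ -> ->.
case/andP=> ac cp bp aA bA; have [cA|cA] := boolP (c \in A).
  exact: IHp cp bp cA bA.
by exists a, c.
Qed.

Lemma metric_path (A : {set T}) (d : T -> T -> nat) a b : tree_metric A d ->
  {in A &, forall x y, adj x y = (d x y == 1)} -> a \in A -> b \in A ->
  exists p, [/\ path (@adj T) a p, last a p = b, size p = d a b & all (mem A) p].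
Proof.
move=> dA dE; move dab: (d a b) => n; elim: n a dab => [|n IHn] a dab aA bA.
  by exists [::]; split=> //=; apply: tm_eq dA _ _ _ _ dab.
have ab : a != b by apply: contra_eq_neq dab => ->; rewrite (tm_refl dA).
have [w wA [aw awb]] := tm_step dA aA bA ab.
have [|p [wp bp sz pA]] := IHn w _ wA bA; first by lia.
by exists (w :: p); rewrite /= dE // aw wp sz pA wA.
Qed.

Hypothesis treeT : is_tree T.

(* A second neighbour of [v] in [A] would close a cycle. *)
Lemma unique_attachment (A : {set T}) (d : T -> T -> nat) u w v :
  tree_metric A d -> {in A &, forall x y, adj x y = (d x y == 1)} ->
  u \in A -> w \in A -> v \notin A -> adj u v -> adj w v -> w = u.
Proof.
move=> dA dE uA wA vA uv wv; apply/eqP/negPn/negP => wu.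
have [p [up pw _ pA]] := metric_path dA dE uA wA.
case/shortenP: up pw => q uq uniq_q sub_q qw.
have qA : {subset u :: q <= A}.
  by move=> x; rewrite inE => /predU1P[-> //|/sub_q xp]; apply: (allP pA).
have: ucycle (@adj T) (v :: u :: q).
  apply/andP; split; rewrite /=.
    by rewrite adj_sym uv rcons_path uq qw.
  rewrite -/(uniq (u :: q)) uniq_q andbT.
  by apply: contra vA => /qA.
have [_ acT] := treeT; move/acT => /=.
by case: q {uq uniq_q sub_q qA} qw => //= qw; rewrite -qw eqxx in wu.
Qed.

Lemma tree_metric_grow n : n < #|T| -> exists (A : {set T}) d,
  [/\ #|A| = n.+1, tree_metric A d,
      {in A &, forall x y, adj x y = (d x y == 1)} &
      {in A &, forall x y, d x y < #|A|}].
Proof.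
have [[T_gt0 conT] _] := treeT.
elim: n => [|n IHn] ltn.
  have /card_gt0P[r _] := T_gt0.
  exists [set r], (fun _ _ => 0); rewrite cards1; split=> //.
    split=> //.
    + by move=> x y /set1P-> /set1P->; rewrite !eqxx.
    + by move=> x y /set1P-> /set1P->; rewrite eqxx.
  by move=> x y /set1P-> /set1P->; rewrite adj_irrefl.
have [A [d [cA dA dE d_lt]]] := IHn (ltnW ltn).
have /subsetPn[b _ bA] : ~~ ([set: T] \subset A).
  by apply: contraL ltn => /subset_leq_card; rewrite cardsT cA -leqNgt.
have /card_gt0P[a aA] : 0 < #|A| by rewrite cA.
have [u [v [uA vA uv]]] := crossing_edge (conT a b) aA bA.
exists (v |: A), (leaf_metric d u v).
have newE x : x \in A -> adj v x = ((d u x).+1 == 1).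
  move=> xA; rewrite eqSS (tm_eq0 dA) //; apply/idP/eqP => [vx|<-].
    by symmetry; apply: unique_attachment dA dE uA xA vA uv _; rewrite adj_sym.
  by rewrite adj_sym.
split; first by rewrite cardsU1 vA cA.
- exact: tree_metric_add_leaf dA uA vA.
- move=> x y /setU1P[->|xA] /setU1P[->|yA].
  + by rewrite leaf_metric_newnew adj_irrefl.
  + by rewrite (leaf_metric_new _ _ vA) // newE.
  + by rewrite (leaf_metric_newr dA _ vA) // adj_sym newE.
  + by rewrite (leaf_metricE _ _ vA) // dE.
- rewrite cardsU1 vA add1n => x y /setU1P[->|xA] /setU1P[->|yA].
  + by rewrite leaf_metric_newnew.
  + by rewrite (leaf_metric_new _ _ vA) // ltnS d_lt.
  + by rewrite (leaf_metric_newr dA _ vA) // ltnS d_lt.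
  + by rewrite (leaf_metricE _ _ vA) // ltnW // ltnS d_lt.
Qed.

Lemma tree_cube_metric : exists2 d : T -> T -> nat, tree_metric [set: T] d &
  forall x y, @power_adj T 3 x y = (x != y) && (d x y <= 3).
Proof.
have [[T_gt0 conT] _] := treeT.
have [|A [d [cA dA dE d_lt]]] := @tree_metric_grow #|T|.-1.
  by rewrite (prednK T_gt0).
have AT : A = [set: T].
  by apply/eqP; rewrite eqEcard subsetT cardsT cA (prednK T_gt0) leqnn.
move: cA dA dE d_lt; rewrite {A}AT => cA dT dE d_lt.
have inT (x : T) : x \in [set: T] by rewrite inE.
have walk_d n x y : has_walk n x y -> d x y <= n.
  case/existsP=> p /andP[xp /eqP <-]; rewrite -[n in _ <= n](size_tuple p).
  elim: (tval p) x xp => [|z q IHq] x /=; first by rewrite (tm_refl dT).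
  case/andP; rewrite dE // => /eqP xz /IHq.
  by have := tm_triangle dT (inT z) (inT x) (inT (last z q)); rewrite xz; lia.
have d_walk x y : has_walk (d x y) x y.
  have [p [xp py sz _]] := metric_path dT dE (inT x) (inT y).
  have szE : size p == d x y by rewrite sz.
  by apply/existsP; exists (Tuple szE); rewrite /= xp py eqxx.
exists d => // x y; rewrite /power_adj conT /=; congr (_ && _).
have dltT : d x y < #|T| by rewrite -cardsT d_lt.
suff -> : dist x y = d x y by [].
rewrite /dist; set s := iota _ _; set P := (fun _ => _).
have has_s : has P s by apply/hasP; exists (d x y); [rewrite mem_iota | exact: d_walk].
have szs : size s = #|T| by rewrite size_iota.
have lt_find : find P s < #|T| by rewrite -szs -has_find.
apply/eqP; rewrite eqn_leq; apply/andP; split.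
  rewrite leqNgt; apply/negP => /(before_find 0).
  by rewrite nth_iota // add0n /P d_walk.
by have := nth_find 0 has_s; rewrite nth_iota // add0n => /walk_d.
Qed.

End TreeToMetric.

(** * Decks *)

Lemma graph_iso_refl G : graph_iso G G.
Proof. by exists id => //; exists id. Qed.

Lemma graph_iso_sym G H : graph_iso G H -> graph_iso H G.
Proof.
case=> f [g fK gK] f_adj; exists g; first by exists f.
by move=> x y; rewrite -f_adj !gK.
Qed.

Lemma graph_iso_trans G H K : graph_iso G H -> graph_iso H K -> graph_iso G K.
Proof.
case=> f f_bij f_adj [g g_bij g_adj]; exists (g \o f); first exact: bij_comp.
by move=> x y /=; rewrite g_adj f_adj.
Qed.

Lemma card_iso_extend (G H : sgraph) (v : G) (w : H) :
  graph_iso (vertex_deleted v) (vertex_deleted w) ->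
  exists f : G -> H, [/\ injective f, f v = w &
    forall a b, a != v -> b != v -> adj (f a) (f b) = adj a b].
Proof.
case=> f f_bij f_adj.
pose F a := if insub a is Some a' then val (f a') else w.
have FE a (av : a != v) : F a = val (f (exist _ a av)) by rewrite /F insubT.
have Fv : F v = w by rewrite /F insubF // eqxx.
have Fw a : a != v -> F a != w by move=> av; rewrite FE (valP (f _)).
exists F; split=> // [a b|a b av bv]; last first.
  by rewrite !FE -[RHS](f_adj (exist _ a av) (exist _ b bv)).
have [->|av] := eqVneq a v; have [->|bv] := eqVneq b v => //.
- by rewrite Fv => /esym/eqP; rewrite (negPf (Fw _ bv)).
- by rewrite Fv => /eqP; rewrite (negPf (Fw _ av)).
- by rewrite !FE => /val_inj/(bij_inj f_bij)[].
Qed.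

Lemma card_iso_map (G H : sgraph) (f : G -> H) : bijective f ->
  (forall x y, adj (f x) (f y) = adj x y) ->
  forall v, graph_iso (vertex_deleted v) (vertex_deleted (f v)).
Proof.
move=> f_bij f_adj v; have f_inj := bij_inj f_bij.
pose F (a : vertex_deleted v) : vertex_deleted (f v) :=
  exist _ (f (val a)) (contra_neq (@f_inj _ _) (valP a)).
exists F; last by move=> x y; rewrite -[RHS]f_adj.
apply: inj_card_bij; first by move=> a b [/f_inj/val_inj].
by rewrite !card_sig !cardC1 (bij_eq_card f_bij).
Qed.

Lemma same_deck_injection (G H : sgraph) : same_deck G H ->
  exists2 s : G -> H, injective s &
    forall v, graph_iso (vertex_deleted v) (vertex_deleted (s v)).
Proof.
move=> deckGH.
pose A (v : G) := [set u : G | graph_isob (vertex_deleted u) (vertex_deleted v)].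
pose B (v : G) := [set u : H | graph_isob (vertex_deleted u) (vertex_deleted v)].
have cardAB v : #|A v| = #|B v| := deckGH (vertex_deleted v).
have Av v : v \in A v by rewrite inE; apply/graph_isobP/graph_iso_refl.
have dflt (v : G) : H.
  have /card_gt0P/sigW[w _] : 0 < #|B v| by rewrite -cardAB; apply/card_gt0P; exists v.
  exact: w.
have idx v : index v (enum (A v)) < size (enum (B v)).
  by rewrite -cardE -cardAB cardE index_mem mem_enum.
pose s v := nth (dflt v) (enum (B v)) (index v (enum (A v))).
have sB v : s v \in B v by rewrite -mem_enum mem_nth.
have s_iso v : graph_iso (vertex_deleted v) (vertex_deleted (s v)).
  by have := sB v; rewrite inE => /graph_isobP/graph_iso_sym.
exists s => // v w svw.
have vw : graph_iso (vertex_deleted v) (vertex_deleted w).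
  apply: graph_iso_trans (s_iso v) _; rewrite svw.
  exact/graph_iso_sym.
have AE : A v = A w.
  apply/setP=> u; rewrite !inE; apply/graph_isobP/graph_isobP => uv.
    exact: graph_iso_trans uv vw.
  exact: graph_iso_trans uv (graph_iso_sym vw).
have BE : B v = B w.
  apply/setP=> u; rewrite !inE; apply/graph_isobP/graph_isobP => uv.
    exact: graph_iso_trans uv vw.
  exact: graph_iso_trans uv (graph_iso_sym vw).
have vE : v \in enum (A v) by rewrite mem_enum.
have wE : w \in enum (A v) by rewrite mem_enum AE.
apply: (index_inj v vE wE); apply/eqP.
rewrite -(nth_uniq (dflt v) _ _ (enum_uniq (B v))) ?idx //; last first.
  by rewrite BE AE idx.
apply/eqP; move: svw; rewrite /s AE BE => ->.
by apply: set_nth_default; rewrite idx.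
Qed.

(* [f] is an isomorphism from the card of [g] at [v] to the card of [h] at [s v]. *)
Definition hypomorphism (V : finType) (g h : rel V) (s : V -> V) : Prop :=
  forall v, exists f : V -> V, [/\ injective f, f v = s v &
    forall a b, a != v -> b != v -> h (f a) (f b) = g a b].

Lemma same_deck_hypomorphism (G H : sgraph) (x : G) : same_deck H G ->
  exists h s, [/\ [/\ symmetric h, irreflexive h & injective s],
    s x = x, hypomorphism (@adj G) h s,
    (forall a b, a != x -> b != x -> h a b = adj a b) &
    exists2 F : G -> H, bijective F & forall a b, adj (F a) (F b) = h a b].
Proof.
move=> deckHG.
have [s s_inj s_iso] : exists2 s : G -> H, injective s &
    forall v, graph_iso (vertex_deleted v) (vertex_deleted (s v)).
  by apply: same_deck_injection => K.
have [s' s'_inj _] := same_deck_injection deckHG.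
have leHG : #|H| <= #|G| by apply: leq_card s'_inj.
have [F [F_inj Fx F_adj]] := card_iso_extend (s_iso x).
have [F' FK F'K] := inj_card_bij F_inj leHG.
exists (fun a b => adj (F a) (F b)), (F' \o s); split=> //.
- split; [by move=> a b; apply: adj_sym | by move=> a; apply: adj_irrefl |].
  exact: inj_comp (can_inj F'K) s_inj.
- by rewrite /= -Fx FK.
- move=> v; have [f [f_inj fv f_adj]] := card_iso_extend (s_iso v).
  exists (F' \o f); split=> [||a b av bv] /=; last by rewrite !F'K f_adj.
    exact: inj_comp (can_inj F'K) f_inj.
  by rewrite fv.
- by exists F => //; exists F'.
Qed.

Section Invariants.
Variable V : finType.
Implicit Types (r : rel V) (v : V).

Definition degree r v := \sum_u r v u.

(* Ordered pairs of adjacent neighbours: twice the number of triangles at [v]. *)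
Definition triangles_at r v := \sum_a \sum_b [&& r v a, r v b & r a b].

Definition simplicial r v := forall a b, r v a -> r v b -> a != b -> r a b.

Definition arcs r := \sum_a \sum_b r a b.
Definition triangles r := \sum_a \sum_b \sum_c [&& r a b, r a c & r b c].

Lemma bigD1_nat (F : V -> nat) v :
  F v = 0 -> \sum_a F a = \sum_(a | a != v) F a.
Proof. by move=> Fv; rewrite (bigD1 v) //= Fv add0n. Qed.

Lemma arcs_deleted r v : symmetric r -> irreflexive r ->
  arcs r = \sum_(a | a != v) \sum_(b | b != v) r a b + 2 * degree r v.
Proof.
move=> r_sym r_irr; rewrite /arcs (bigD1 v) //= -/(degree r v).
under [X in _ + X = _]eq_bigr => a _ do rewrite (bigD1 v) //=.
rewrite big_split /=.
have -> : \sum_(a | a != v) r a v = degree r v.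
  rewrite -bigD1_nat ?r_irr //; by apply: eq_bigr => a _; rewrite r_sym.
lia.
Qed.

Lemma triangles_deleted r v : symmetric r -> irreflexive r ->
  triangles r =
    \sum_(a | a != v) \sum_(b | b != v) \sum_(c | c != v)
       [&& r a b, r a c & r b c] + 3 * triangles_at r v.
Proof.
move=> r_sym r_irr; rewrite /triangles (bigD1 v) //= -/(triangles_at r v).
under [X in _ + X = _]eq_bigr => a _ do rewrite (bigD1 v) //=.
rewrite big_split /=.
have -> : \sum_(a | a != v) \sum_c [&& r a v, r a c & r v c] = triangles_at r v.
  rewrite -bigD1_nat; last by rewrite big1 // => c _; rewrite r_irr.
  apply: eq_bigr => a _; apply: eq_bigr => c _.
  by rewrite (r_sym a v); case: (r v a); case: (r v c); case: (r a c).
under [X in _ + (_ + X) = _]eq_bigr => a _.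
  under eq_bigr => b _ do rewrite (bigD1 v) //=.
  rewrite big_split /=; over.
rewrite big_split /=.
have -> : \sum_(a | a != v) \sum_(b | b != v) [&& r a b, r a v & r b v] =
    triangles_at r v.
  rewrite -bigD1_nat; last first.
    by rewrite big1 // => b _; rewrite r_irr andbF.
  apply: eq_bigr => a _; rewrite -bigD1_nat; last by rewrite r_irr !andbF.
  apply: eq_bigr => b _; rewrite (r_sym a v) (r_sym b v).
  by case: (r a b); case: (r v a); case: (r v b).
lia.
Qed.

Definition nonadjacent r v : {set V * V} :=
  [set p | [&& r v p.1, r v p.2, p.1 != p.2 & ~~ r p.1 p.2]].

Lemma degree_square r v : irreflexive r ->
  degree r v * degree r v =
    triangles_at r v + degree r v + #|nonadjacent r v|.
Proof.
move=> r_irr; pose bad a b := [&& r v a, r v b, a != b & ~~ r a b].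
have -> : #|nonadjacent r v| = \sum_a \sum_b bad a b.
  rewrite pair_bigA /= -sum1_card big_mkcond /=.
  by apply: eq_bigr => -[a b] _; rewrite inE /bad /=; case: ifP.
rewrite {1 2}/degree big_distrl /= /triangles_at.
have -> : degree r v = \sum_a \sum_b [&& r v a, r v b & a == b].
  apply: eq_bigr => a _; rewrite (bigD1 a) //= eqxx andbT andbb big1 ?addn0 // => b.
  by rewrite eq_sym => /negPf->; rewrite !andbF.
rewrite -!big_split /=; apply: eq_bigr => a _.
rewrite big_distrr -!big_split /=; apply: eq_bigr => b _; rewrite mulnb /bad.
have [<-|_] := eqVneq a b; rewrite ?r_irr; case: (r v a) => //=; case: (r v b) => //=.
by case: (r a b).
Qed.

Lemma simplicial_count r v : irreflexive r ->
  simplicial r v <-> triangles_at r v + degree r v = degree r v * degree r v.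
Proof.
move=> r_irr; rewrite (degree_square v r_irr); split=> [v_simp|].
  rewrite (_ : #|_| = 0) ?addn0 //; apply: eq_card0 => -[a b]; rewrite inE /=.
  by apply/negP => /and4P[va vb ab]; rewrite v_simp.
move/eqP; rewrite -{1}[triangles_at _ _ + _]addn0 eqn_add2l eq_sym cards_eq0.
move=> /eqP/setP bad0 a b va vb ab; have := bad0 (a, b).
by rewrite !inE /= va vb ab /= => /negPn.
Qed.

Variables (g h : rel V) (s : V -> V).
Hypotheses (g_sym : symmetric g) (g_irr : irreflexive g).
Hypotheses (h_sym : symmetric h) (h_irr : irreflexive h).
Hypotheses (s_inj : injective s) (gh : hypomorphism g h s).
Hypothesis V_gt2 : 2 < #|V|.

Lemma hypo_sum (F : V -> nat) : \sum_v F (s v) = \sum_v F v.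
Proof. by rewrite [RHS](reindex s) //; apply: onW_bij; apply: injF_bij. Qed.

Lemma hypo_arcs_deleted v :
  \sum_(a | a != v) \sum_(b | b != v) g a b =
  \sum_(a | a != s v) \sum_(b | b != s v) h a b.
Proof.
have [f [f_inj fv fE]] := gh v.
have f_bij P : {on P, bijective f} by apply: onW_bij; apply: injF_bij.
have fneq a : (f a != s v) = (a != v) by rewrite -fv (inj_eq f_inj).
rewrite [RHS](reindex f) //= (eq_bigl _ _ fneq); apply: eq_bigr => a av.
rewrite [RHS](reindex f) //= (eq_bigl _ _ fneq); apply: eq_bigr => b bv.
by rewrite fE.
Qed.

Lemma hypo_triangles_deleted v :
  \sum_(a | a != v) \sum_(b | b != v) \sum_(c | c != v) [&& g a b, g a c & g b c] =
  \sum_(a | a != s v) \sum_(b | b != s v) \sum_(c | c != s v)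
    [&& h a b, h a c & h b c].
Proof.
have [f [f_inj fv fE]] := gh v.
have f_bij P : {on P, bijective f} by apply: onW_bij; apply: injF_bij.
have fneq a : (f a != s v) = (a != v) by rewrite -fv (inj_eq f_inj).
rewrite [RHS](reindex f) //= (eq_bigl _ _ fneq); apply: eq_bigr => a av.
rewrite [RHS](reindex f) //= (eq_bigl _ _ fneq); apply: eq_bigr => b bv.
rewrite [RHS](reindex f) //= (eq_bigl _ _ fneq); apply: eq_bigr => c cv.
by rewrite !fE.
Qed.

Lemma hypo_arcs : arcs g = arcs h.
Proof.
have sumE r : symmetric r -> irreflexive r -> #|V| * arcs r =
    \sum_v \sum_(a | a != v) \sum_(b | b != v) r a b + 2 * arcs r.
  move=> r_sym r_irr; have -> : 2 * arcs r = \sum_v 2 * degree r v by rewrite -big_distrr.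
  rewrite -big_split -sum_nat_const; apply: eq_bigr => v _; exact: arcs_deleted.
have := sumE g g_sym g_irr; have := sumE h h_sym h_irr.
rewrite -(hypo_sum (fun v => \sum_(a | a != v) \sum_(b | b != v) h a b)).
under eq_bigr => v _ do rewrite -hypo_arcs_deleted.
by move: (\sum_i _) => X; have := V_gt2; clear; nia.
Qed.

Lemma hypo_degree v : degree h (s v) = degree g v.
Proof.
have := arcs_deleted v g_sym g_irr; have := arcs_deleted (s v) h_sym h_irr.
rewrite hypo_arcs -hypo_arcs_deleted => -> /eqP.
by rewrite eqn_add2l eqn_pmul2l // => /eqP.
Qed.

Lemma hypo_degree_sq :
  \sum_v degree h v * degree h v = \sum_v degree g v * degree g v.
Proof.
rewrite -(hypo_sum (fun v => degree h v * degree h v)).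
by apply: eq_bigr => v _; rewrite hypo_degree.
Qed.

Hypothesis V_gt3 : 3 < #|V|.

Lemma hypo_triangles : triangles g = triangles h.
Proof.
have sumE r : symmetric r -> irreflexive r -> #|V| * triangles r =
    \sum_v \sum_(a | a != v) \sum_(b | b != v) \sum_(c | c != v)
       [&& r a b, r a c & r b c] + 3 * triangles r.
  move=> r_sym r_irr; have -> : 3 * triangles r = \sum_v 3 * triangles_at r v.
    by rewrite -big_distrr.
  rewrite -big_split -sum_nat_const; apply: eq_bigr => v _.
  exact: triangles_deleted.
have := sumE g g_sym g_irr; have := sumE h h_sym h_irr.
rewrite -(hypo_sum (fun v => \sum_(a | a != v) \sum_(b | b != v)
  \sum_(c | c != v) [&& h a b, h a c & h b c])).
under eq_bigr => v _ do rewrite -hypo_triangles_deleted.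
by move: (\sum_i _) => X; have := V_gt3; clear; nia.
Qed.

Lemma hypo_triangles_at v : triangles_at h (s v) = triangles_at g v.
Proof.
have := triangles_deleted v g_sym g_irr.
have := triangles_deleted (s v) h_sym h_irr.
rewrite hypo_triangles -hypo_triangles_deleted => -> /eqP.
by rewrite eqn_add2l eqn_pmul2l // => /eqP.
Qed.

Lemma hypo_simplicial v : simplicial h (s v) <-> simplicial g v.
Proof. by rewrite !simplicial_count // hypo_degree hypo_triangles_at. Qed.

End Invariants.

(** * Tree metrics on a whole type *)

Section Total.
Variables (V : finType) (d : V -> V -> nat).
Hypothesis dT : tree_metric [set: V] d.
Let inT (v : V) : v \in [set: V]. Proof. by rewrite inE. Qed.

Definition dist_refl u : d u u = 0 := tm_refl dT (inT u).
Definition dist_sym u v : d u v = d v u := tm_sym dT (inT u) (inT v).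
Definition dist_tri w u v : d u v <= d u w + d w v :=
  tm_triangle dT (inT w) (inT u) (inT v).
Definition dist_nbr a b v := tm_nbr dT (inT a) (inT b) (inT v).
Definition dist_two a b c v := tm_two_nbrs dT (inT a) (inT b) (inT c) (inT v).
Definition dist_split a b u v := tm_split dT (inT a) (inT b) (inT u) (inT v).
Definition dist_even a b c := tm_even dT (inT a) (inT b) (inT c).
Definition dist_gt0 u v := tm_gt0 dT (inT u) (inT v).
Definition dist_eq u v := tm_eq dT (inT u) (inT v).

Lemma dist_point u v k : k <= d u v -> exists w, d u w = k /\ d u v = k + d w v.
Proof. by move=> /(tm_point dT (inT u) (inT v))[w _ wP]; exists w. Qed.

Lemma dist_step u v : u != v -> exists w, d u w = 1 /\ d u v = (d w v).+1.
Proof. by move=> /(tm_step dT (inT u) (inT v))[w _ wP]; exists w. Qed.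

Lemma tree_metric_sub_leaf y : (forall u v, d y u = 1 -> d y v = 1 -> u = v) ->
  tree_metric [set~ y] d.
Proof.
move=> y_leaf; split.
- by move=> u v _ _; apply: (tm_eq0 dT).
- by move=> u v _ _; apply: dist_sym.
- move=> u v; rewrite !inE => uy vy uv; have [w [uw uv']] := dist_step uv.
  exists w => //; rewrite !inE; apply: contra_neq uv => wy.
  have [w' [ww' wv]] : exists w', d w w' = 1 /\ d w v = (d w' v).+1.
    by apply: dist_step; rewrite wy eq_sym.
  have wu : d y u = 1 by rewrite -wy dist_sym.
  rewrite wy in ww'; have uw' := y_leaf _ _ wu ww'; subst w'; lia.
- by move=> u v w _ _ _; apply: dist_even.
- by move=> u v w z _ _ _ _; apply: (tm_4pc dT).
Qed.

End Total.

(** * Two tree metrics whose cubes agree off a vertex *)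

(* Levels are distances from [l]. The path [c1], [x], [b], [z], [t], [r3] starts
   at level [k - 2], and [b] is the first vertex of the tree where paths from
   [l] diverge. The cube of [d] is known off [x], that of [d1] off [y]. *)
Section TwoMetrics.
Variables (V : finType) (d d1 : V -> V -> nat) (l x b c1 z j t r3 y : V) (k : nat).
Hypothesis dT : tree_metric [set: V] d.
Local Notation A := [set~ y].
Hypothesis d1A : tree_metric A d1.
Hypotheses (k_gt1 : 1 < k) (k_lt5 : k < 5).
Hypothesis xE : forall v, d x v = (d l v - k.-1) + (k.-1 - d l v).
Hypothesis bE : forall v, d b v = (d l v - k) + (k - d l v).
Hypothesis low_uniq : forall u v, d l u = d l v -> d l u <= k -> u = v.
Hypothesis lc1 : d l c1 = k - 2.
Hypotheses (lz : d l z = k.+1) (lj : d l j = k.+1) (zj : z != j).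
Hypotheses (lt : d l t = k.+2) (zt : d z t = 1).
Hypotheses (lr3 : d l r3 = k.+3) (tr3 : d t r3 = 1).
Hypothesis y_leaf : forall u v, d y u = 1 -> d y v = 1 -> u = v.
Hypotheses (xy : x != y) (c1y : c1 != y) (r3y : r3 != y) (by_gt1 : 1 < d b y).
Variable h : rel V.
Hypothesis hE : forall u v, u != x -> v != x -> h u v = (u != v) && (d u v <= 3).
Hypothesis hE1 : {in A &, forall u v, h u v = (u != v) && (d1 u v <= 3)}.

Let agree u v : u \in A -> v \in A -> u != x -> v != x ->
  (d1 u v <= 3) = (d u v <= 3).
Proof.
move=> uA vA ux vx; have [->|uv] := eqVneq u v.
  by rewrite (dist_refl dT) (tm_refl d1A).
by have := hE1 uA vA; rewrite hE // uv.
Qed.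

Let dA : tree_metric A d := tree_metric_sub_leaf dT y_leaf.

Let sep u v : d l u < k -> k <= d l v -> d u v = d b u + d b v.
Proof.
move=> lu lv; apply: (@dist_split _ _ dT b x); have := xE b; have := bE b;
  have := bE u; have := xE u; have := bE v; have := xE v;
  have := dist_sym dT x b; have := dist_refl dT b; dlia.
Qed.

Let lb : d l b = k.
Proof. by have := bE b; have := dist_refl dT b; dlia. Qed.
Let lx : d l x = k.-1.
Proof. by have := xE x; have := dist_refl dT x; dlia. Qed.

Let xA : x \in A. Proof. by rewrite !inE. Qed.
Let c1A : c1 \in A. Proof. by rewrite !inE. Qed.
Let r3A : r3 \in A. Proof. by rewrite !inE. Qed.
Let zA : z \in A.
Proof. by rewrite !inE; apply: contraTneq by_gt1 => <-; rewrite bE lz; dlia. Qed.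
Let jA : j \in A.
Proof. by rewrite !inE; apply: contraTneq by_gt1 => <-; rewrite bE lj; dlia. Qed.
Let bA : b \in A.
Proof. by rewrite !inE; apply: contraTneq by_gt1 => <-; rewrite dist_refl. Qed.
Let tA : t \in A.
Proof.
rewrite !inE; apply: contra_eq_neq lr3 => ty.
have zr : z = r3 by apply: y_leaf; rewrite -ty // dist_sym.
by rewrite -zr lz; dlia.
Qed.

Let c1x : c1 != x. Proof. by apply: contra_eq_neq lc1 => ->; rewrite lx; dlia. Qed.
Let bx : b != x. Proof. by apply: contra_eq_neq lb => ->; rewrite lx; dlia. Qed.
Let zx : z != x. Proof. by apply: contra_eq_neq lz => ->; rewrite lx; dlia. Qed.
Let jx : j != x. Proof. by apply: contra_eq_neq lj => ->; rewrite lx; dlia. Qed.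
Let tx : t != x. Proof. by apply: contra_eq_neq lt => ->; rewrite lx; dlia. Qed.
Let r3x : r3 != x. Proof. by apply: contra_eq_neq lr3 => ->; rewrite lx; dlia. Qed.

Lemma visible_center : exists2 w, w \in A &
  [/\ forall v, v \in A -> v != x -> (d1 w v <= 1) = (d b v <= 1),
      d1 c1 t = d1 c1 w + d1 w t, 1 < d1 c1 w & 1 < d1 w t].
Proof.
have [||||w wA [c1t c1w wt wD]] := @tm_separator _ _ _ d1A
  (fun v => d b v <= 1) (fun v => d l v < k) c1 t c1A tA.
- by rewrite /= bE lc1; dlia.
- by rewrite /= bE lt; dlia.
- by rewrite /= lc1 lt; dlia.
- move=> u v uA vA /= bu bv uv.
  have ux : u != x by apply: contraNneq bu => ->; rewrite bE lx; dlia.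
  have vx : v != x by apply: contraNneq bv => ->; rewrite bE lx; dlia.
  rewrite agree // in uv; case: (ltnP (d l u) k) => lu; case: (ltnP (d l v) k) => lv //.
    by have := sep lu lv; dlia.
  by have := sep lv lu; rewrite dist_sym //; dlia.
exists w => //; split=> // v vA vx; apply/idP/idP => [/wD|]; first by apply.
have wc1 : w != c1.
  by apply: contraTneq c1w => ->; rewrite (tm_refl d1A).
have [g gA [wg wc1E]] := tm_step d1A wA c1A wc1.
have c1w_sym := tm_sym d1A c1A wA.
have nbr_g u (uA : u \in A) := tm_nbr d1A wA gA uA wg.
have [|||| w2 w2A [c1t2 c1w2 w2t w2D]] := @tm_separator _ _ _ dA
  (fun v => (v == x) || (d1 w v <= 1)) (fun v => d1 g v < d1 w v) c1 t c1A tA.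
- by rewrite /= negb_or c1x; dlia.
- by rewrite /= negb_or tx; dlia.
- rewrite /=; have := tm_triangle d1A gA c1A tA; have := tm_sym d1A c1A gA.
  by have := nbr_g t tA; move=> *; apply/eqP; dlia.
- move=> u w' uA w'A /=; rewrite !negb_or => /andP[ux wu] /andP[w'x ww'] uw'.
  rewrite -agree // in uw'.
  case: (ltnP (d1 g u) (d1 w u)) => gu; case: (ltnP (d1 g w') (d1 w w')) => gw' //.
  + have := tm_split d1A wA gA uA w'A wg; have := nbr_g u uA; have := nbr_g w' w'A.
    by dlia.
  + have := tm_split d1A wA gA w'A uA wg; have := nbr_g u uA; have := nbr_g w' w'A.
    by rewrite (tm_sym d1A w'A uA); dlia.
have c1t4 : d c1 t = 4 by rewrite sep ?bE ?lc1 ?lt; dlia.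
have w2b : w2 = b.
  apply: (tm_uniq dA c1A tA w2A bA) => //; have := bE c1; have := bE t;
  have := dist_sym dT c1 b; dlia.
by move=> bv; have := w2D v vA; rewrite w2b bv (negPf vx) => /(_ isT).
Qed.

Let Hb_c1 : d b c1 = 2. Proof. by rewrite bE lc1; dlia. Qed.
Let Hb_z : d b z = 1. Proof. by rewrite bE lz; dlia. Qed.
Let Hb_j : d b j = 1. Proof. by rewrite bE lj; dlia. Qed.
Let Hb_t : d b t = 2. Proof. by rewrite bE lt; dlia. Qed.
Let Hb_r3 : d b r3 = 3. Proof. by rewrite bE lr3; dlia. Qed.
Let Hb_b : d b b = 0. Proof. exact: dist_refl. Qed.
Let Hb_x : d b x = 1. Proof. by rewrite bE lx; dlia. Qed.
Let Hz_r3 : d z r3 = 2.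
Proof.
by have := dist_tri dT t z r3; have := dist_tri dT z b r3; dlia.
Qed.

Let far_branch g g' v : d b g = 1 -> d b g' = 1 -> g != g' ->
  d b v = (d g v).+1 -> d g' v = (d b v).+1.
Proof.
by move=> bg bg' gg' bv; have := @dist_two _ _ dT b g g' v bg bg' gg'; dlia.
Qed.

Let Hj_r3 : d j r3 = 4.
Proof. by rewrite (far_branch Hb_z) // Hb_r3 ?Hz_r3. Qed.

Let adj1 u v : u \in A -> v \in A -> u != x -> v != x -> d u v <= 3 -> d1 u v <= 3.
Proof. by move=> uA vA ux vx uv; rewrite agree. Qed.
Let nadj1 u v : u \in A -> v \in A -> u != x -> v != x -> 3 < d u v -> 3 < d1 u v.
Proof. by move=> uA vA ux vx uv; rewrite ltnNge agree // -ltnNge. Qed.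

Let center_cases w : w \in A ->
  (forall v, v \in A -> v != x -> (d1 w v <= 1) = (d b v <= 1)) ->
  w != b -> w = z /\ d1 b r3 <= 2.
Proof.
move=> wA wJ wb.
have wb1 : d1 w b <= 1 by rewrite wJ // Hb_b.
have wz1 : d1 w z <= 1 by rewrite wJ // Hb_z.
have wj1 : d1 w j <= 1 by rewrite wJ // Hb_j.
have wr3 : 1 < d1 w r3 by rewrite ltnNge wJ // Hb_r3.
have br3 := adj1 bA r3A bx r3x (eq_leq Hb_r3).
have zr3 : d1 z r3 <= 3 by rewrite adj1 ?Hz_r3.
have jr3 : 3 < d1 j r3 by rewrite nadj1 ?Hj_r3.
have wb2 := tm_gt0 d1A wA bA wb.
have wb3 : d1 w b = 1 by dlia.
have wr3' : 2 < d1 w r3.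
  by have := tm_triangle d1A wA jA r3A; have := tm_sym d1A jA wA; dlia.
have := tm_nbr d1A wA bA r3A wb3 => nbr_b.
have [wz|wz] := eqVneq w z; first by split=> //; move: nbr_b wr3'; rewrite wz => *; dlia.
have wz2 := tm_gt0 d1A wA zA wz.
have wz3 : d1 w z = 1 by dlia.
have bz : b != z by apply: contra_eq_neq Hb_z => <-; rewrite dist_refl.
by have := tm_two_nbrs d1A wA bA zA r3A wb3 wz3 bz; dlia.
Qed.

Hypothesis y_simplicial : forall u v, h y u -> h y v -> u != v -> h u v.
Hypothesis h_sym : symmetric h.
Hypothesis h_irr : irreflexive h.
Hypothesis h_deg : #|[set v | h x v]| = #|[set v | (x != v) && (d x v <= 3)]|.
Hypothesis ly : k < 4 -> l != y.
Hypothesis hxl : l != y -> h x l.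
Hypothesis c2_ex : 2 < k -> exists2 c2, c2 != y & d l c2 = k - 3.
Hypothesis branch_ex : k = 2 ->
  (exists2 r4, r4 != y & d l r4 = k.+4 /\ d r3 r4 = 1) \/
  (exists v3 e, [/\ v3 != y, d l v3 = k.+3, d l e = k.+1, e != z & d e v3 = 2]).

Let J1 : forall v, v \in A -> v != x -> (d1 b v <= 1) = (d b v <= 1).
Proof.
have [w wA [wJ _ _ _]] := visible_center.
have [wb|wb] := eqVneq w b; first by move=> v vA vx; rewrite -wJ // wb.
have [wz br3] := center_cases wA wJ wb.
rewrite {}wz in wA wJ wb *; exfalso.
have zb2 := tm_gt0 d1A wA bA wb.
have zb1 : d1 z b <= 1 by rewrite wJ // Hb_b.
have zb : d1 z b = 1 by dlia.
case: (ltnP 2 k) => [k_gt2|k_le2].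
  have [c2 c2y lc2] := c2_ex k_gt2.
  have c2A : c2 \in A by rewrite !inE.
  have c2x : c2 != x by apply: contra_eq_neq lc2 => ->; rewrite lx; dlia.
  have bc2 : d1 b c2 <= 3 by rewrite adj1 // bE lc2; dlia.
  have zc2 : 3 < d1 z c2 by rewrite nadj1 // dist_sym // sep ?Hb_z ?bE ?lc2 ?lz; dlia.
  have c12 : d1 c1 c2 <= 3.
    rewrite adj1 //; have [e [ce c2e]] : exists e, d c2 e = 1 /\ d c2 b = 1 + d e b.
      by apply: (dist_point dT); rewrite dist_sym // bE lc2; dlia.
    have le : d l e = d l c1.
      by have := bE e; have := bE c2; have := dist_sym dT c2 b; have := dist_sym dT e b;
        have := dist_tri dT c2 l e; dlia.
    have ec1 : e = c1 by apply: low_uniq; dlia.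
    by have := dist_sym dT c1 c2; rewrite ec1 in ce; dlia.
  have jc1 : d1 j c1 <= 3 by rewrite adj1 // dist_sym // sep ?Hb_j ?Hb_c1 ?lc1 ?lj; dlia.
  have c1r3 : 3 < d1 c1 r3 by rewrite nadj1 // sep ?Hb_c1 ?Hb_r3 ?lc1 ?lr3; dlia.
  have zj1 : d1 z j <= 1 by rewrite wJ // Hb_j.
  have zj2 := tm_gt0 d1A zA jA zj.
  have zj3 : d1 z j = 1 by dlia.
  have bj : b != j by apply: contra_eq_neq Hb_j => <-; rewrite dist_refl.
  have := tm_two_nbrs d1A zA bA jA c1A zb zj3 bj.
  have := tm_nbr d1A zA bA c2A zb; have := tm_nbr d1A zA bA c1A zb.
  have := tm_nbr d1A zA jA c1A zj3.
  have := tm_split d1A zA bA c2A c1A zb; have := tm_sym d1A c1A c2A.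
  by have := tm_triangle d1A bA c1A r3A; have := tm_sym d1A c1A bA; dlia.
have k2 : k = 2 by dlia.
case: (branch_ex k2) => [[r4 r4y [lr4 r34]]|[v3 [e [v3y lv3 le ez ev3]]]].
- have r4A : r4 \in A by rewrite !inE.
  have r4x : r4 != x by apply: contra_eq_neq lr4 => ->; rewrite lx; dlia.
  have br4 : 3 < d1 b r4 by rewrite nadj1 // bE lr4; dlia.
  have zr4 : d1 z r4 <= 3.
    by rewrite adj1 //; have := dist_tri dT r3 z r4; dlia.
  have r34' : d1 r3 r4 <= 3 by rewrite adj1 ?r34.
  have zr3 : 1 < d1 z r3 by rewrite ltnNge wJ // Hb_r3.
  have := tm_nbr d1A zA bA r4A zb; have := tm_nbr d1A zA bA r3A zb.
  by have := tm_split d1A zA bA r3A r4A zb; dlia.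
- have v3A : v3 \in A by rewrite !inE.
  have v3x : v3 != x by apply: contra_eq_neq lv3 => ->; rewrite lx; dlia.
  have be : d b e = 1 by rewrite bE le; dlia.
  have eA : e \in A by rewrite !inE; apply: contraTneq by_gt1 => <-; rewrite be.
  have ex : e != x by apply: contra_eq_neq le => ->; rewrite lx; dlia.
  have bv3 : d b v3 = 3 by rewrite bE lv3; dlia.
  have zv3 : d z v3 = 4 by rewrite (far_branch be) // bv3 ?ev3.
  have zv3' : 3 < d1 z v3 by rewrite nadj1 ?zv3.
  have bv3' : d1 b v3 <= 3 by rewrite adj1 ?bv3.
  have ev3' : d1 e v3 <= 3 by rewrite adj1 ?ev3.
  have ze1 : d1 z e <= 1 by rewrite wJ // be.
  have ze2 : 0 < d1 z e by rewrite (tm_gt0 d1A) // eq_sym.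
  have ze3 : d1 z e = 1 by dlia.
  have be' : b != e by apply: contra_eq_neq be => <-; rewrite dist_refl.
  have := tm_two_nbrs d1A zA bA eA v3A zb ze3 be'.
  by have := tm_nbr d1A zA bA v3A zb; have := tm_nbr d1A zA eA v3A ze3; dlia.
Qed.

Let S := [set v | h x v].
Let S0 := [set v | (x != v) && (d x v <= 3)].

Let J1z : d1 b z = 1.
Proof.
have := J1 zA zx; rewrite Hb_z /=; have := tm_gt0 d1A bA zA.
have bz : b != z by apply: contra_eq_neq Hb_z => <-; rewrite dist_refl.
by move/(_ bz); dlia.
Qed.
Let J1j : d1 b j = 1.
Proof.
have := J1 jA jx; rewrite Hb_j /=; have := tm_gt0 d1A bA jA.
have bj : b != j by apply: contra_eq_neq Hb_j => <-; rewrite dist_refl.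
by move/(_ bj); dlia.
Qed.

Let nbr_high g : g \in A -> g != x -> d1 b g = 1 -> d b g = 1 /\ d l g = k.+1.
Proof.
move=> gA gx bg; have bg1 : d b g <= 1 by rewrite -J1 // bg.
have bg' : b != g by apply: contra_eq_neq bg => <-; rewrite (tm_refl d1A).
have bg2 : d b g = 1 by have := dist_gt0 dT bg'; dlia.
split=> //; have lg : d l g <> k.-1.
  by move=> lg; case/eqP: gx; apply: low_uniq; rewrite ?lx ?lg //; dlia.
by have := bE g; dlia.
Qed.

Let c2_toward c2 : 2 < k -> c2 != y -> d l c2 = k - 3 ->
  d1 b x = 1 /\ d1 b c2 = (d1 x c2).+1.
Proof.
move=> k_gt2 c2y lc2.
have c2A : c2 \in A by rewrite !inE.
have c2x : c2 != x by apply: contra_eq_neq lc2 => ->; rewrite lx; dlia.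
have bc2 : b != c2 by apply: contra_eq_neq lc2 => <-; rewrite lb; dlia.
have bc2' : d1 b c2 <= 3 by rewrite adj1 // bE lc2; dlia.
have [g gA [bg bc2E]] := tm_step d1A bA c2A bc2.
have [gx|gx] := eqVneq g x; first by rewrite -gx.
have [bg1 lg] := nbr_high gA gx bg.
have : 3 < d1 g c2 by rewrite nadj1 // dist_sym // sep ?bg1 ?bE ?lc2 ?lg; dlia.
by dlia.
Qed.

Let x_nbr : d1 b x = 1.
Proof.
case: (ltnP 2 k) => [k_gt2|k_le2].
  by have [c2 c2y lc2] := c2_ex k_gt2; have [] := c2_toward k_gt2 c2y lc2.
have k2 : k = 2 by dlia.
have k_lt4 : k < 4 by dlia.
have c1l : c1 = l by apply: low_uniq; rewrite lc1 k2 ?dist_refl.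
apply/eqP/negPn/negP => bx1.
have bx2 : 1 < d1 b x by have := tm_gt0 d1A bA xA bx; case: (d1 b x) bx1 => [|[]].
have bc1 : 1 < d1 b c1 by rewrite ltnNge J1 // Hb_c1.
have bc1n : b != c1 by apply: contra_eq_neq Hb_c1 => <-; rewrite dist_refl.
have [g gA [bg bc1E]] := tm_step d1A bA c1A bc1n.
have gx : g != x by apply: contra_neq bx1 => <-.
have [bg1 lg] := nbr_high gA gx bg.
have gc1 : d1 g c1 = 1.
  have c1z : d1 z c1 <= 3 by rewrite adj1 // dist_sym // sep ?Hb_z ?Hb_c1 ?lc1 ?lz; dlia.
  have c1j : d1 j c1 <= 3 by rewrite adj1 // dist_sym // sep ?Hb_j ?Hb_c1 ?lc1 ?lj; dlia.
  have [gz|gz] := eqVneq g z.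
    have gj : g != j by rewrite gz.
    by have := tm_two_nbrs d1A bA gA jA c1A bg J1j gj; dlia.
  by have := tm_two_nbrs d1A bA gA zA c1A bg J1z gz; dlia.
have cg := tm_sym d1A c1A gA; have cb := tm_sym d1A c1A bA.
have hxc1 : d1 x c1 <= 3.
  have := hxl (ly k_lt4); by rewrite -c1l hE1 // => /andP[].
have bxE : d1 b x = (d1 g x).+1.
  have := tm_nbr d1A bA gA xA bg; have := tm_split d1A bA gA c1A xA bg.
  by have := tm_sym d1A xA c1A; dlia.
have near e : e \in A -> e != x -> e != c1 -> d1 c1 e <= 3 -> d b e <= 1.
  move=> eA ex ec1; rewrite agree // => c1e.
  have le : 2 <= d l e.
    rewrite ltnNge; apply/negP => le1; have : d l e = 0 \/ d l e = 1 by dlia.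
    case=> le'.
      by case/eqP: ec1; apply: low_uniq; rewrite ?lc1 le' k2.
    by case/eqP: ex; apply: low_uniq; rewrite ?lx le' k2.
  by move: c1e; rewrite sep ?lc1 ?k2 ?Hb_c1 //; dlia.
have near_g e : e \in A -> e != x -> e != c1 -> d1 c1 e <= 3 ->
    d1 b e = (d1 g e).+1 -> d1 g e = 0.
  by move=> eA ex ec1 c1e beE; have := near e eA ex ec1 c1e; rewrite -J1 //; dlia.
have S_sub v : v \in A -> h x v -> v = c1 \/ d b v <= 1.
  move=> vA hxv; have vx : v != x by apply: contraTneq hxv => ->; rewrite h_irr.
  have xv : d1 x v <= 3 by move: hxv; rewrite hE1 // => /andP[].
  have [->|vc1] := eqVneq v c1; [by left | right].
  have [gv|bvE] : d1 g v = (d1 b v).+1 \/ d1 b v = (d1 g v).+1.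
  - by have := tm_nbr d1A bA gA vA bg; dlia.
  - rewrite -J1 //; have := tm_split d1A bA gA xA vA bg bxE gv.
    by have := tm_sym d1A xA bA; dlia.
  - have [c1v|c1v] := leqP (d1 c1 v) 3; first exact: near c1v.
    have gv3 : 2 < d1 g v by have := tm_triangle d1A gA c1A vA; dlia.
    have [p1 p1A [gp1 gvE1]] := tm_point d1A gA vA (ltnW (ltnW gv3)).
    have p1v2 : 1 < d1 p1 v by dlia.
    have [p2 p2A [p12 p1vE]] := tm_point d1A p1A vA (ltnW p1v2).
    have p2v1 : 0 < d1 p2 v by dlia.
    have [p3 p3A [p23 p2vE]] := tm_point d1A p2A vA p2v1.
    have gp2 : d1 g p2 = 2.
      by have := tm_triangle d1A p1A gA p2A; have := tm_triangle d1A p2A gA vA; dlia.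
    have gp3 : d1 g p3 = 3.
      by have := tm_triangle d1A p2A gA p3A; have := tm_triangle d1A p3A gA vA; dlia.
    have beyond e : e \in A -> d1 g v = d1 g e + d1 e v -> d1 b e = (d1 g e).+1.
      move=> eA gve; have := tm_triangle d1A gA bA eA.
      by have := tm_triangle d1A eA bA vA; dlia.
    have is_x e : e \in A -> d1 g v = d1 g e + d1 e v -> 0 < d1 g e ->
        d1 c1 e <= 3 -> e = x \/ e = c1.
      move=> eA gve ge c1e; have [->|ex] := eqVneq e x; first by left.
      have [->|ec1] := eqVneq e c1; first by right.
      by have := near_g e eA ex ec1 c1e (beyond e eA gve); dlia.
    have p2x : p2 = x.
      case: (is_x p2) => //; try dlia.
        by have := tm_triangle d1A gA c1A p2A; dlia.
      by move=> p2c1; move: gp2; rewrite p2c1 gc1.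
    have p1c1 : p1 = c1.
      case: (is_x p1) => //; try dlia.
        by have := tm_triangle d1A gA c1A p1A; dlia.
      by move=> p1x; move: gp1; rewrite p1x -p2x gp2.
    case: (is_x p3) => //; try dlia.
    + by have := tm_triangle d1A p2A c1A p3A; rewrite -p1c1; dlia.
    + by move=> p3x; move: gp3; rewrite p3x -p2x gp2.
    + by move=> p3c1; move: gp3; rewrite p3c1 gc1.
pose J := c1 |: [set v | (v != x) && (d b v <= 1)].
have S_J : S \subset y |: J.
  apply/subsetP=> v; rewrite !inE => hxv; have [//|vy] := eqVneq v y.
  have vA : v \in A by rewrite !inE.
  case: (S_sub v vA hxv) => [->|->]; first by rewrite eqxx.
  rewrite andbT /=; apply/orP; right; apply: contraTneq hxv => ->.
  by rewrite h_irr.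
have J_y : y \notin J by rewrite !inE eq_sym (negPf c1y) leqNgt by_gt1 andbF.
have J_t : t \notin J.
  rewrite !inE Hb_t andbF orbF.
  by apply: contra_eq_neq lt => ->; rewrite lc1; dlia.
have J_S0 : t |: J \subset S0.
  apply/subsetP=> v /setU1P[->|].
    by rewrite inE eq_sym tx xE lt; dlia.
  rewrite !inE => /orP[/eqP->|/andP[vx bv]].
    by rewrite eq_sym c1x xE lc1; dlia.
  by rewrite eq_sym vx; have := xE v; have := bE v; dlia.
have cS0 : #|J| + 1 + (y \in S0) <= #|S0|.
  have [yS0|_] := boolP (y \in S0).
    have /subset_leq_card : y |: (t |: J) \subset S0.
      by apply/subsetP=> v /setU1P[->//|]; apply: (subsetP J_S0).
    have ty : y != t by have := tA; rewrite !inE eq_sym.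
    by rewrite cardsU1 in_setU1 negb_or ty J_y cardsU1 J_t /=; dlia.
  by have := subset_leq_card J_S0; rewrite cardsU1 J_t; dlia.
have yS : h x y.
  apply: contraTT cS0 => hxy; rewrite -ltnNge -h_deg.
  have /subset_leq_card : S \subset J; last by rewrite /S; dlia.
  apply/subsetP=> v vS; have := subsetP S_J v vS; case/setU1P=> // vy.
  by rewrite inE vy (negPf hxy) in vS.
have yS0 : y \notin S0.
  apply: contraTN cS0 => ->; rewrite -ltnNge -h_deg.
  by have := subset_leq_card S_J; rewrite cardsU1 J_y /S; dlia.
have yb : y != b by have := bA; rewrite !inE eq_sym.
have [u [yu ybE]] := dist_step dT yb.
have d_xy : 3 < d x y by move: yS0; rewrite inE xy /= -ltnNge.
have ux : u != x by apply: contra_eq_neq yu => ->; rewrite dist_sym //; dlia.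
have uy : u != y by apply: contra_eq_neq yu => ->; rewrite dist_refl.
have yx : y != x by rewrite eq_sym.
have hyu : h y u by rewrite hE // eq_sym uy yu.
have hxu : h x u by apply: y_simplicial; rewrite // 1?eq_sym // h_sym.
have uA : u \in A by rewrite !inE.
have xc1 : d x c1 = 1 by rewrite xE lc1; dlia.
case: (S_sub u uA hxu) => [uc1|bu].
  rewrite uc1 in yu; have := dist_tri dT c1 x y; have := dist_sym dT c1 y; dlia.
have := dist_tri dT b x y; have := dist_tri dT u b y; have := dist_sym dT u y.
by have := dist_sym dT b x; dlia.
Qed.

Let xb1 : d1 x b = 1. Proof. by rewrite (tm_sym d1A). Qed.

Let ball2 v : v \in A -> v != x -> (d1 b v <= 2) = (d b v <= 2).
Proof.
move=> vA vx; apply/idP/idP => bv.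
  have z1 : d z v <= 3.
    by rewrite -agree //; have := tm_nbr d1A bA zA vA J1z; dlia.
  have j1 : d j v <= 3.
    by rewrite -agree //; have := tm_nbr d1A bA jA vA J1j; dlia.
  by have := @dist_two _ _ dT b z j v Hb_z Hb_j zj; dlia.
have z1 : d1 z v <= 3.
  by rewrite agree //; have := @dist_nbr _ _ dT b z v Hb_z; dlia.
have j1 : d1 j v <= 3.
  by rewrite agree //; have := @dist_nbr _ _ dT b j v Hb_j; dlia.
by have := tm_two_nbrs d1A bA zA jA vA J1z J1j zj; dlia.
Qed.

Let ball_sub v : v \in A -> v != x -> d x v <= 3 -> h x v.
Proof.
move=> vA vx xv; have vy : v != y by move: vA; rewrite !inE.
have h_near : d1 x v <= 3 -> h x v by rewrite hE1 // eq_sym vx.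
have [bv|bv] := leqP (d b v) 2.
  apply: h_near; move: bv; rewrite -ball2 //.
  by have := tm_triangle d1A bA xA vA; dlia.
have lvk : d l v < k by have := bE v; have := xE v; dlia.
have [lv|lv] : d l v = k - 3 /\ 2 < k \/ d l v = 0 /\ k = 4.
- by have := bE v; have := xE v; dlia.
- case: lv => lv k_gt2; have [_ bvE] := c2_toward k_gt2 vy lv.
  apply: h_near; suff : d1 b v <= 3 by dlia.
  have bx' : b != x by [].
  by rewrite agree // bE; dlia.
- case: lv => lv k4; have vl : v = l by apply: low_uniq; rewrite ?lv ?dist_refl.
  by rewrite vl; apply: hxl; rewrite -vl.
Qed.

Let level3 m : m \in A -> m != x -> d1 b m = 3 -> d1 b m = (d1 x m).+1 ->
  d l m = k - 3 /\ 2 < k.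
Proof.
move=> mA mx bm bxm.
have bm3 : d b m = 3.
  have : d b m <= 3 by rewrite -agree // bm.
  have : 2 < d b m by rewrite ltnNge -ball2 // bm.
  dlia.
have [lm|lm] := ltnP (d l m) k; first by have := bE m; dlia.
have bm' : b != m by apply: contra_eq_neq bm3 => <-; rewrite dist_refl.
have [g [bg bmE]] := dist_step dT bm'.
have gx : g != x by apply: contra_eq_neq bmE => ->; have := bE m; have := xE m; dlia.
have gA : g \in A by rewrite !inE; apply: contraTneq by_gt1 => <-; rewrite bg.
have bg1 : d1 b g = 1.
  have : d1 b g <= 1 by rewrite J1 // bg.
  have bg' : b != g by apply: contra_eq_neq bg => <-; rewrite dist_refl.
  by have := tm_gt0 d1A bA gA bg'; dlia.
have gm : d1 g m <= 3 by rewrite agree //; dlia.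
have xg : x != g by rewrite eq_sym.
by have := tm_two_nbrs d1A bA xA gA mA x_nbr bg1 xg; dlia.
Qed.

Let sub_ball v : v \in A -> h x v -> d x v <= 3.
Proof.
move=> vA hxv; have vx : v != x by apply: contraTneq hxv => ->; rewrite h_irr.
have xv : d1 x v <= 3 by move: hxv; rewrite hE1 // => /andP[].
have [bv|bv] := leqP (d1 b v) 2.
  by move: bv; rewrite ball2 //; have := dist_tri dT b x v; have := dist_sym dT b x; dlia.
have bxv : d1 b v = (d1 x v).+1 by have := tm_nbr d1A bA xA vA x_nbr; dlia.
have [bv3|bv4] : d1 b v = 3 \/ d1 b v = 4 by dlia.
  by have [lv k_gt2] := level3 vA vx bv3 bxv; rewrite xE lv; dlia.
have bv3 : 3 <= d1 b v by dlia.
have [m mA [bm bvE]] := tm_point d1A bA vA bv3.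
have mx : m != x by apply: contra_eq_neq bm => ->; rewrite x_nbr.
have bxm : d1 b m = (d1 x m).+1.
  have := tm_nbr d1A bA xA mA x_nbr; have := tm_sym d1A vA mA.
  by have := tm_split d1A bA xA vA mA x_nbr bxv; dlia.
have [lm k_gt2] := level3 mA mx bm bxm.
have bm2 : 2 <= d1 b m by dlia.
have [p pA [bp bmE]] := tm_point d1A bA mA bm2.
have px : p != x by apply: contra_eq_neq bp => ->; rewrite x_nbr.
have pb : p != b by apply: contra_eq_neq bp => ->; rewrite (tm_refl d1A).
have bp2 : d b p <= 2 by rewrite -ball2 ?bp.
have pm : d p m <= 3 by rewrite -agree //; dlia.
have pv : d p v <= 3.
  by rewrite -agree //; have := tm_triangle d1A mA pA vA; dlia.
have lmk : d l m < k by dlia.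
have lp : d l p < k.
  rewrite ltnNge; apply/negP => lp; have := sep lmk lp; have := dist_sym dT m p.
  by have := bE m; have := dist_gt0 dT pb; have := dist_sym dT p b; dlia.
have bp2' : d b p = 2.
  have lpx : d l p <> k.-1.
    by move=> lp1; case/eqP: px; apply: low_uniq; rewrite ?lx ?lp1 //; dlia.
  by have := bE p; dlia.
have [lv|lv] := ltnP (d l v) k; first by rewrite xE; dlia.
have bv1 : d b v <= 2 by have := sep lp lv; dlia.
by move: bv1; rewrite -ball2 // bv4.
Qed.

Lemma hole_filled : forall v, h x v = (x != v) && (d x v <= 3).
Proof.
have off_y v : v != y -> (v \in S) = (v \in S0).
  move=> vy; have vA : v \in A by rewrite !inE.
  rewrite !inE; have [<-|xv] := eqVneq x v; first by rewrite h_irr.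
  have vx : v != x by rewrite eq_sym.
  by apply/idP/idP => [/(sub_ball vA)|/(ball_sub vA vx)].
have SE : S :\ y = S0 :\ y.
  apply/setP=> v; rewrite in_setD1 [in RHS]in_setD1.
  by case: (eqVneq v y) => //= vy; apply: off_y.
have := h_deg; rewrite -/S -/S0 (cardsD1 y S) (cardsD1 y S0) SE => /eqP.
rewrite eqn_add2r => yE v; have [->|vy] := eqVneq v y; last first.
  by have := off_y v vy; rewrite !inE.
by move: yE; rewrite !inE; case: (h x y); case: (_ && _).
Qed.

End TwoMetrics.

Lemma card_degree (V : finType) (r : rel V) v : degree r v = #|[set u | r v u]|.
Proof.
by rewrite /degree -sum1_card [RHS]big_mkcond; apply: eq_bigr => u _; rewrite inE.
Qed.

Lemma tree_metric_pull (V : finType) (A B : {set V}) (d : V -> V -> nat)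
  (f f' : V -> V) : cancel f f' -> cancel f' f ->
  (forall a, (f' a \in A) = (a \in B)) ->
  tree_metric A d -> tree_metric B (fun a c => d (f' a) (f' c)).
Proof.
move=> fK f'K AB dA; split.
- by move=> a c aB cB /=; rewrite (tm_eq0 dA) ?AB // (can_eq f'K).
- by move=> a c aB cB /=; rewrite (tm_sym dA) ?AB.
- move=> a c aB cB ac; have [|||w wA wE] := @tm_step _ _ _ dA (f' a) (f' c).
  + by rewrite AB.
  + by rewrite AB.
  + by rewrite (can_eq f'K).
  by exists (f w); rewrite ?fK // -AB fK.
- by move=> a c e aB cB eB /=; rewrite (tm_even dA) ?AB.
- by move=> a c e w aB cB eB wB /=; apply: (tm_4pc dA); rewrite ?AB.
Qed.

(** * Cubes of tree metrics *)

Section CubeMetric.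
Variables (V : finType) (d : V -> V -> nat).
Hypothesis dT : tree_metric [set: V] d.

Definition cube : rel V := fun a b => (a != b) && (d a b <= 3).

Lemma cube_sym : symmetric cube.
Proof. by move=> a b; rewrite /cube eq_sym (dist_sym dT). Qed.

Lemma cube_irr : irreflexive cube.
Proof. by move=> a; rewrite /cube eqxx. Qed.

Lemma cube_simplicialP v : simplicial cube v <->
  forall a b, d v a <= 3 -> d v b <= 3 -> d a b <= 3.
Proof.
split=> [simp a b va vb | simp a b /andP[_ va] /andP[_ vb] ab].
  have [->|ab] := eqVneq a b; first by rewrite (dist_refl dT).
  have [<-//|av] := eqVneq v a.
  have [<-|bv] := eqVneq v b; first by rewrite (dist_sym dT).
  have : cube a b by apply: simp; rewrite // /cube ?av ?bv.
  by case/andP.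
by rewrite /cube ab simp.
Qed.

Lemma farthest_simplicial u v : (forall w, d u w <= d u v) -> simplicial cube v.
Proof.
move=> far_v; apply/cube_simplicialP => a b va vb.
have inT (w : V) : w \in [set: V] by rewrite inE.
have := tm_4pc dT (inT a) (inT b) (inT u) (inT v).
by have := far_v a; have := far_v b; have := dist_sym dT u v;
  have := dist_sym dT u a; have := dist_sym dT u b; have := dist_sym dT v a;
  have := dist_sym dT v b; dlia.
Qed.

Lemma ex_farthest (u : V) : exists v, forall w, d u w <= d u v.
Proof. by have [v _ vP] := @arg_maxnP _ u xpredT (d u) isT; exists v => w; apply: vP. Qed.

Lemma level_dist l k : (forall u v, d l u = d l v -> d l u <= k -> u = v) ->
  forall q v, d l q <= k -> d q v = (d l v - d l q) + (d l q - d l v).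
Proof.
move=> uniq q v qk; have [qv|vq] := leqP (d l q) (d l v).
  have [w [lw ->]] := dist_point dT qv.
  by rewrite -(uniq w q) ?lw //; dlia.
have [w [lw ->]] := dist_point dT (ltnW vq).
by rewrite -(uniq w v) ?lw ?(dist_sym dT q) //; dlia.
Qed.

Lemma cube_degree v : (degree cube v).+1 = #|[set u | d v u <= 3]|.
Proof.
rewrite card_degree [in RHS](cardsD1 v) inE (dist_refl dT) add1n; congr _.+1.
by apply: eq_card => u; rewrite !inE /cube eq_sym.
Qed.

Hypothesis far : forall v, exists r, 3 < d v r.

Lemma simplicial_leaf v : simplicial cube v ->
  forall a c, d v a = 1 -> d v c = 1 -> a = c.
Proof.
move/cube_simplicialP => simp.
have [r vr] := far v.
have [p [vp vrE]] := dist_point dT (ltnW vr).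
have v_p : v != p by apply: contra_eq_neq vp => <-; rewrite (dist_refl dT).
have [g [vg vpE]] := dist_step dT v_p.
suff uniq_g a : d v a = 1 -> a = g by move=> a c /uniq_g-> /uniq_g->.
move=> va; apply/eqP/negPn/negP => ag.
have := @dist_two _ _ dT v a g p va vg ag.
by have := simp a p; dlia.
Qed.

Lemma degree3_simplicial v : degree cube v <= 3 -> simplicial cube v.
Proof.
rewrite card_degree => deg3; have [r vr] := far v.
have vr1 : 0 < d v r by dlia.
have [p1 [vp1 vrE]] := dist_point dT vr1.
have p1r : 0 < d p1 r by dlia.
have [p2 [p12 p1rE]] := dist_point dT p1r.
have p2r : 0 < d p2 r by dlia.
have [p3 [p23 p2rE]] := dist_point dT p2r.
have t12 := dist_tri dT p1 v p2; have t23 := dist_tri dT p2 v p3.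
have t13 := dist_tri dT p2 p1 p3.
have neq a c : d a r <> d c r -> a != c.
  by move=> ac; apply/eqP => E; apply: ac; rewrite E.
pose P := p1 |: (p2 |: [set p3]).
have cP : #|P| = 3.
  rewrite /P cardsU1 cardsU1 cards1 !inE negb_or !neq //; dlia.
have PE : P = [set u | cube v u].
  apply/eqP; rewrite eqEcard cP deg3 andbT; apply/subsetP=> u.
  by rewrite !inE => /orP[/eqP->|/orP[/eqP->|/eqP->]]; rewrite /cube neq //=; dlia.
have dP a : cube v a -> a \in P by rewrite PE inE.
move=> a c /dP aP /dP cP' ac; rewrite /cube ac /=.
have := dist_sym dT p1 p2; have := dist_sym dT p2 p3; have := dist_sym dT p1 p3.
move: aP cP' ac; rewrite !inE.
by case/or3P=> /eqP-> /or3P[] /eqP-> _; rewrite ?(dist_refl dT); dlia.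
Qed.

Lemma card_gt3 : inhabited V -> 3 < #|V|.
Proof.
case=> v; have [r vr] := far v.
have vr1 : 0 < d v r by dlia.
have [p1 [vp1 vrE]] := dist_point dT vr1.
have p1r : 0 < d p1 r by dlia.
have [p2 [p12 p1rE]] := dist_point dT p1r.
have neq a c : d a r <> d c r -> a != c.
  by move=> ac; apply/eqP => E; apply: ac; rewrite E.
have rr := dist_refl dT r.
have : #|v |: (p1 |: (p2 |: [set r]))| = 4.
  by rewrite !cardsU1 cards1 !inE !negb_or !neq //; dlia.
by move=> <-; apply: max_card.
Qed.

End CubeMetric.

(** * Recovering the neighbourhood of a deleted vertex *)

Section Hole.
Variables (V : finType) (d : V -> V -> nat).
Hypothesis dT : tree_metric [set: V] d.
Notation g := (cube d).
Variables (h : rel V) (s : V -> V) (x : V).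
Hypotheses (h_sym : symmetric h) (h_irr : irreflexive h).
Hypotheses (s_inj : injective s) (sx : s x = x) (gh : hypomorphism g h s).
Hypothesis hx : forall a b, a != x -> b != x -> h a b = g a b.
Hypothesis V_gt2 : 2 < #|V|.

Let g_sym := cube_sym dT.
Let g_irr := cube_irr d.

Definition matched :=
  exists2 p : V -> V, injective p & forall a b, h (p a) (p b) = g a b.

Lemma hole_id : (forall v, h x v = g x v) -> matched.
Proof.
move=> hxE; exists id => // a b.
have [->|ax] := eqVneq a x; first exact: hxE.
have [->|bx] := eqVneq b x; first by rewrite h_sym g_sym.
exact: hx.
Qed.

Lemma hole_card : #|[set v | h x v]| = #|[set v | g x v]|.
Proof. by rewrite -!card_degree -{1}sx (hypo_degree g_sym). Qed.

Lemma hole_sub : (forall v, h x v -> g x v) -> matched.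
Proof.
move=> sub; apply: hole_id => v.
suff: [set v | h x v] = [set v | g x v] by move/setP/(_ v); rewrite !inE.
apply/eqP; rewrite eqEcard hole_card leqnn andbT.
by apply/subsetP=> u; rewrite !inE; apply: sub.
Qed.

Lemma hole_universal : (forall v, d x v <= 3) -> matched.
Proof.
move=> univ; apply: hole_sub => v xv; rewrite /cube univ andbT.
by apply: contraTneq xv => ->; rewrite h_irr.
Qed.

Lemma hole_degree_off v : v != x -> degree h v + g v x = degree g v + h v x.
Proof.
move=> vx; rewrite /degree (bigD1 x) //= [in RHS](bigD1 x) //=.
have -> : \sum_(i | i != x) h v i = \sum_(i | i != x) g v i.
  by apply: eq_bigr => i ix; rewrite hx.
by move: (\sum_(i | _) _) => X; lia.
Qed.

Lemma hole_preimage v : exists u, s u = v.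
Proof. by have [s' _ K] := injF_bij s_inj; exists (s' v). Qed.

Hypothesis far : forall v, exists r, 3 < d v r.
Variable l : V.
Hypothesis l_simp : simplicial g l.
Hypothesis l_min : forall u, simplicial g u -> degree g l <= degree g u.

Let V_gt3 : 3 < #|V| := card_gt3 dT far (inhabits x).

Lemma hole_min v : simplicial h v -> degree g l <= degree h v.
Proof.
have [u <-] := hole_preimage v.
case: (hypo_simplicial g_sym g_irr h_sym h_irr s_inj gh V_gt2 V_gt3 u) => H _ /H.
by rewrite (hypo_degree g_sym) //; apply: l_min.
Qed.

(* Were [v] not adjacent to [x] in [h], it would be simplicial there with degree
   one less than the minimum. *)
Lemma hole_forced v : simplicial g v -> degree g v = degree g l -> g x v -> h x v.
Proof.
move=> v_simp v_deg xv; apply/negPn/negP => hxv.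
have vx : v != x by apply: contraTneq xv => ->; rewrite g_irr.
have hvx a : h v a -> a != x by apply: contraTneq => ->; rewrite h_sym (negPf hxv).
have vh_simp : simplicial h v.
  move=> a b va vb ab; have ax := hvx a va; have bx := hvx b vb.
  by rewrite hx //; apply: v_simp; rewrite // -hx.
have := hole_min vh_simp; have := hole_degree_off vx.
by rewrite v_deg g_sym xv h_sym (negPf hxv); dlia.
Qed.

Lemma hole_simplicial u : simplicial g u -> simplicial h (s u).
Proof. by case: (hypo_simplicial g_sym g_irr h_sym h_irr s_inj gh V_gt2 V_gt3 u). Qed.

Lemma hole_twin u v : d l u = 2 -> d l v = 2 -> u != v -> x = l -> matched.
Proof.
move=> lu lv uv xl.
have [r lr] := far l.
have lr2 : 2 < d l r by dlia.
have [w3 [lw3 lr3E]] := dist_point dT lr2.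
have lw32 : 1 < d l w3 by dlia.
have [w [lw lw3E]] := dist_point dT lw32.
have {u v lu lv uv} [v [lv vw]] : exists v, d l v = 2 /\ v != w.
  by have [uw|uw] := eqVneq u w; [exists v; rewrite -uw eq_sym | exists u].
have leaf := simplicial_leaf dT far l_simp.
have lw1 : 0 < d l w by dlia.
have [p [lp lwE]] := dist_point dT lw1.
have pE q : q != l -> d l q = (d p q).+1.
  rewrite eq_sym => lq; have [p' [lp' ->]] := dist_step dT lq.
  by rewrite (leaf p p').
have lneq q : d l q <> 0 -> q != l.
  by move=> lq; apply/eqP => E; apply: lq; rewrite E (dist_refl dT).
have pv : d p v = 1 by have := pE v; rewrite lneq; dlia.
have pw : d p w = 1 by have := pE w; rewrite lneq; dlia.
have pw3 : d p w3 = 2 by have := pE w3; rewrite lneq; dlia.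
have /cube_simplicialP-/(_ dT) simp := l_simp.
have lv_near q : (d l q <= 3) = (d v q <= 3).
  apply/idP/idP => [lq | vq]; first by apply: simp => //; rewrite lv.
  have [->|ql] := eqVneq q l; first by rewrite (dist_refl dT).
  have [vpq|pvq] := dist_nbr dT q pv; last by have := pE q ql; dlia.
  have [<-|nvq] := eqVneq v q; first by rewrite lv.
  have [q1 [vq1 vqE]] := dist_step dT nvq.
  have pq1 : d p q1 = 2.
    have := dist_tri dT v p q1; have := dist_tri dT q1 p q; dlia.
  have lq1 : d l q1 <= 3 by have := dist_tri dT p l q1; dlia.
  have lw3' : d l w3 <= 3 by dlia.
  have := simp _ _ lq1 lw3'.
  have vq1E : d p q1 = (d v q1).+1 by dlia.
  have [vw3|ww3] := dist_two dT w3 pv pw vw; last by dlia.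
  by have := dist_split dT pv vq1E vw3; have := dist_sym dT q1 w3; dlia.
have v_simp : simplicial g v.
  by apply/(cube_simplicialP dT) => a b; rewrite -!lv_near; apply: simp.
have lx : v != x by rewrite xl lneq //; dlia.
have xv : g x v by rewrite /cube eq_sym lx xl; dlia.
have v_deg : degree g v = degree g l.
  apply: succn_inj; rewrite !(cube_degree dT).
  by apply: eq_card => q; rewrite !inE lv_near.
have hxv := hole_forced v_simp v_deg xv.
have x_simp : simplicial h x by rewrite -sx; apply: hole_simplicial; rewrite xl.
apply: hole_sub => a hxa; have ax : a != x by apply: contraTneq hxa => ->; rewrite h_irr.
have [->//|av] := eqVneq a v.
have := x_simp _ _ hxv hxa; rewrite eq_sym hx // => /(_ av) /andP[_ va].
by rewrite /cube eq_sym ax xl lv_near va.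
Qed.

Section Path.
Hypothesis lx : d l x = 1.
Hypothesis low_uniq : forall u v, d l u = d l v -> d l u <= 5 -> u = v.

Lemma hole_path : matched.
Proof.
have lvl := level_dist dT low_uniq.
have ll := dist_refl dT l.
have neq u v : d l u <> d l v -> u != v.
  by move=> uv; apply/eqP => E; apply: uv; rewrite E.
have xE v : d x v = (d l v - 1) + (1 - d l v) by rewrite lvl lx.
have lE v : g l v = (0 < d l v <= 3).
  rewrite /cube; have [<-|lv] := eqVneq l v; first by rewrite ll.
  by rewrite (dist_gt0 dT).
have gxE v : g x v = (d l v != 1) && (d l v <= 4).
  rewrite /cube xE; congr (_ && _); last by lia.
  congr (~~ _); apply/eqP/eqP => [<-//|lv]; apply: low_uniq; rewrite lx ?lv //.
have [r xr] := far x.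
have lr5 : 5 <= d l r by have := xE r; dlia.
have pt i : i <= 5 -> exists q, d l q = i.
  by move=> i5; have [q []] := dist_point dT (leq_trans i5 lr5); exists q.
have [q2 l2] := pt 2 isT; have [q3 l3] := pt 3 isT.
have [q4 l4] := pt 4 isT; have [q5 l5] := pt 5 isT.
have l_deg : degree g l <= 3.
  rewrite -ltnS (cube_degree dT).
  apply: (@leq_trans #|l |: (x |: (q2 |: [set q3]))|); last first.
    by rewrite !cardsU1 cards1; do !case: (_ \notin _).
  apply: subset_leq_card; apply/subsetP=> v; rewrite !inE => lv.
  have : d l v = 0 \/ d l v = 1 \/ d l v = 2 \/ d l v = 3 by dlia.
  case=> [E|[E|[E|E]]]; [have ->: v = l|have ->: v = x|have ->: v = q2|have ->: v = q3];
    rewrite ?eqxx ?orbT //; apply: low_uniq; rewrite E ?ll ?lx ?l2 ?l3 //.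
have lx' : l != x by apply: neq; rewrite ll lx.
have q2x : q2 != x by apply: neq; rewrite l2 lx.
have q3x : q3 != x by apply: neq; rewrite l3 lx.
have hxl : h x l by apply: hole_forced => //; rewrite gxE ll.
have lh_simp : simplicial h l.
  have [u su] := hole_preimage l; rewrite -su; apply: hole_simplicial.
  apply: (degree3_simplicial dT far).
  rewrite -(hypo_degree g_sym g_irr h_sym h_irr s_inj gh V_gt2) su.
  have := hole_degree_off lx'; rewrite h_sym hxl g_sym gxE ll /=; dlia.
have hlx : h l x by rewrite h_sym.
have hx2 : h x q2.
  by apply: lh_simp; rewrite 1?eq_sym // hx // lE l2.
have hx3 : h x q3.
  by apply: lh_simp; rewrite 1?eq_sym // hx // lE l3.
have S_card : #|[set v | h x v]| <= 4.
  rewrite hole_card.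
  apply: (@leq_trans #|l |: (q2 |: (q3 |: [set q4]))|); last first.
    by rewrite !cardsU1 cards1; do !case: (_ \notin _).
  apply: subset_leq_card; apply/subsetP=> v; rewrite !inE gxE => /andP[lv lv4].
  have lv1 : d l v <> 1 by apply/eqP.
  have : d l v = 0 \/ d l v = 2 \/ d l v = 3 \/ d l v = 4 by dlia.
  case=> [E|[E|[E|E]]]; [have ->: v = l|have ->: v = q2|have ->: v = q3|have ->: v = q4];
    rewrite ?eqxx ?orbT //; apply: low_uniq; rewrite E ?ll ?l2 ?l3 ?l4 //.
have nonadj_card : #|nonadjacent h x| <= 2.
  have tE : triangles_at h x = triangles_at g x.
    by rewrite -{1}sx (hypo_triangles_at g_sym).
  have dE : degree h x = degree g x by rewrite -{1}sx (hypo_degree g_sym).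
  have -> : #|nonadjacent h x| = #|nonadjacent g x|.
    have := degree_square x h_irr; rewrite tE dE (degree_square x g_irr); dlia.
  apply: (@leq_trans #|[set (l, q4); (q4, l)]|); last by rewrite cards2; case: (_ != _).
  apply: subset_leq_card; apply/subsetP=> -[a b]; rewrite !inE /= !gxE.
  case/and4P=> /andP[_ a4] /andP[_ b4] ab; rewrite /cube ab /= -ltnNge.
  rewrite lvl; last by dlia.
  move=> ab3.
  have : d l a = 0 /\ d l b = 4 \/ d l a = 4 /\ d l b = 0 by dlia.
  case=> [] [aE bE]; apply/orP; [left | right]; apply/eqP; congr (_, _);
    by apply: low_uniq; rewrite ?aE ?bE ?ll ?l4.
(* Otherwise [(e, q2)] and [(e, l)] are nonadjacent pairs of neighbours of [x]
   in [h], whereas [(l, q4)] is the only such pair in the cube. *)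
have S_low e : h x e -> d l e <= 5.
  move=> hxe; rewrite leqNgt; apply/negP => e5.
  have ex : e != x by apply: neq; dlia.
  have el : e != l by apply: neq; dlia.
  have eq2 : e != q2 by apply: neq; dlia.
  have ql : q2 != l by apply: neq; dlia.
  have nhe2 : ~~ h e q2.
    by rewrite hx // g_sym /cube eq_sym eq2 /= lvl l2 //; dlia.
  have nhel : ~~ h e l by rewrite hx // g_sym lE; dlia.
  suff : 4 <= #|nonadjacent h x| by dlia.
  apply: (@leq_trans #|(e, q2) |: ((q2, e) |: ((e, l) |: [set (l, e)]))|).
    rewrite !cardsU1 cards1 !inE !xpair_eqE ?eqxx (negPf el) (negPf eq2).
    by rewrite (negPf ql) (eq_sym q2 e) (negPf eq2) (eq_sym l e) (negPf el).
  apply: subset_leq_card; apply/subsetP=> -[a c]; rewrite !inE !xpair_eqE /=.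
  have nh2e : ~~ h q2 e by rewrite h_sym.
  have nhle : ~~ h l e by rewrite h_sym.
  have le : l != e by rewrite eq_sym.
  have q2e : q2 != e by rewrite eq_sym.
  by case/or4P=> /andP[/eqP-> /eqP->]; apply/and4P; split.
have SE v : h x v -> v \in [:: l; q2; q3; q4; q5].
  move=> hxv; have := S_low v hxv.
  have vx : v != x by apply: contraTneq hxv => ->; rewrite h_irr.
  have lv1 : d l v <> 1.
    by move=> lv; move/eqP: vx; apply; apply: low_uniq; rewrite lv.
  move=> lv5; rewrite !inE.
  have : d l v = 0 \/ d l v = 2 \/ d l v = 3 \/ d l v = 4 \/ d l v = 5 by dlia.
  case=> [E|[E|[E|[E|E]]]];
  [have ->: v = l|have ->: v = q2|have ->: v = q3|have ->: v = q4|have ->: v = q5];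
    rewrite ?eqxx ?orbT //; apply: low_uniq; rewrite E ?ll ?l2 ?l3 ?l4 ?l5 //.
have [hx5|nhx5] := boolP (h x q5); last first.
  apply: hole_sub => v hxv; have := SE v hxv; rewrite !inE.
  case/or4P=> [||| /orP[]] /eqP E; rewrite gxE E ?ll ?l2 ?l3 ?l4 //.
  by move: nhx5; rewrite -E hxv.
have nhx4 : ~~ h x q4.
  apply/negP => hx4; suff : 5 <= #|[set v | h x v]| by dlia.
  apply: (@leq_trans #|l |: (q2 |: (q3 |: (q4 |: [set q5])))|).
    by rewrite !cardsU1 cards1 !inE !negb_or !neq //; dlia.
  apply: subset_leq_card; apply/subsetP=> v; rewrite !inE.
  by case/or4P=> [||| /orP[]] /eqP->.
have q4x : q4 != x by apply: neq; dlia.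
have q5x : q5 != x by apply: neq; dlia.
have q45 : q4 != q5 by apply: neq; dlia.
have hxE v : v != q4 -> v != q5 -> h x v = g x v.
  move=> v4 v5; apply/idP/idP => [hxv | ].
    have := SE v hxv; rewrite !inE (negPf v4) (negPf v5) !orbF.
    by case/or3P=> /eqP->; rewrite gxE ?ll ?l2 ?l3.
  rewrite gxE => /andP[lv lv4].
  have lv1 : d l v <> 1 by apply/eqP.
  have : d l v = 0 \/ d l v = 2 \/ d l v = 3 \/ d l v = 4 by dlia.
  case=> [E|[E|[E|E]]].
  - by have ->: v = l by apply: low_uniq; rewrite E ?ll.
  - by have ->: v = q2 by apply: low_uniq; rewrite E ?l2.
  - by have ->: v = q3 by apply: low_uniq; rewrite E ?l3.
  - by case/eqP: v4; apply: low_uniq; rewrite E ?l4.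
have deg4 : degree g q4 = (degree h q4).+1.
  by have := hole_degree_off q4x; rewrite g_sym gxE l4 h_sym (negPf nhx4) /=; dlia.
have deg5 : degree h q5 = (degree g q5).+1.
  by have := hole_degree_off q5x; rewrite g_sym gxE l5 h_sym hx5 /=; dlia.
have degE : degree g q4 = (degree g q5).+1.
  have := hypo_degree_sq g_sym g_irr h_sym h_irr s_inj gh V_gt2.
  rewrite (bigD1 q4) //= (bigD1 q5) 1?eq_sym //=.
  rewrite [in RHS](bigD1 q4) //= [in RHS](bigD1 q5) 1?eq_sym //=.
  rewrite (eq_bigr (fun v => degree g v * degree g v)); last first.
    move=> v /andP[v4 v5].
    suff -> : degree h v = degree g v by [].
    have [->|vx] := eqVneq v x; first by rewrite -{1}sx (hypo_degree g_sym).
    by have := hole_degree_off vx; rewrite h_sym hxE // g_sym; dlia.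
  by move: (\sum_(i | _) _) => X; rewrite deg4 deg5; clear; nia.
have q4E v : d q4 v = (d l v - 4) + (4 - d l v) by rewrite lvl l4.
have q5E v : d q5 v = (d l v - 5) + (5 - d l v) by rewrite lvl l5.
(* [q5] is adjacent to level 8 and [q4] to [x] instead, so [degE] leaves no
   room for a vertex of level 8. *)
have no8 v : d l v <> 8.
  move=> lv; have := cube_degree dT q4; have := cube_degree dT q5.
  rewrite degE (cardsD1 v [set u | d q5 u <= 3]) (cardsD1 x [set u | d q4 u <= 3]).
  rewrite !inE q4E q5E lx lv /= => cB cA.
  suff : #|[set u | d q4 u <= 3] :\ x| <= #|[set u | d q5 u <= 3] :\ v| by dlia.
  apply: subset_leq_card; apply/subsetP=> u; rewrite !inE q4E q5E.
  case/andP=> ux u4; have lu1 : d l u <> 1.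
    by move=> lu; move/eqP: ux; apply; apply: low_uniq; rewrite lu.
  by rewrite neq /=; dlia.
have twin v : v != x -> v != q4 -> v != q5 -> g q4 v = g q5 v.
  move=> vx v4 v5; rewrite /cube eq_sym v4 eq_sym v5 /= q4E q5E.
  have lv1 : d l v <> 1.
    by move=> lv; move/eqP: vx; apply; apply: low_uniq; rewrite lv.
  by have lv8 := no8 v; apply/idP/idP; dlia.
exists (tperm q4 q5) => [|a b]; first exact: perm_inj.
have px v : (tperm q4 q5 v == x) = (v == x).
  by rewrite -{1}(tpermD q4x q5x) (inj_eq perm_inj).
have hxp v : h x (tperm q4 q5 v) = g x v.
  case: tpermP => [->|->|/eqP v4 /eqP v5]; last exact: hxE.
    by rewrite hx5 gxE l4.
  by rewrite (negPf nhx4) gxE l5.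
have [->|ax] := eqVneq a x; first by rewrite {1}tpermD.
have [->|bx] := eqVneq b x.
  by rewrite h_sym [X in h X _]tpermD // hxp g_sym.
rewrite hx ?px //.
case: (tpermP q4 q5 a) => [->|->|/eqP a4 /eqP a5];
  case: (tpermP q4 q5 b) => [->|->|/eqP b4 /eqP b5] //.
- by rewrite !g_irr.
- by rewrite -twin.
- by rewrite !g_irr.
- by rewrite twin.
- by rewrite g_sym -twin // g_sym.
- by rewrite g_sym twin // g_sym.
Qed.

End Path.

Lemma hole_other_simplicial f0 : exists2 u, simplicial g u & s u != f0.
Proof.
have [m m_far] := ex_farthest d l.
have [<-|] := eqVneq (s l) f0; last by exists l.
exists m; first exact: farthest_simplicial m_far.
rewrite (inj_eq s_inj); have [r lr] := far l; have := m_far r.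
by apply: contraTneq => ->; rewrite (dist_refl dT) -ltnNge; dlia.
Qed.

Section Branch.
Variables (k : nat) (b j1 j2 : V).
Hypotheses (k_gt1 : 1 < k) (k_lt5 : k < 5).
Hypothesis low_uniq : forall u v, d l u = d l v -> d l u <= k -> u = v.
Hypotheses (lx : d l x = k.-1) (lb : d l b = k).
Hypotheses (lj1 : d l j1 = k.+1) (lj2 : d l j2 = k.+1) (j12 : j1 != j2).

Let lvl q v : d l q <= k -> d q v = (d l v - d l q) + (d l q - d l v).
Proof. exact: level_dist low_uniq q v. Qed.

Let xE v : d x v = (d l v - k.-1) + (k.-1 - d l v).
Proof. by rewrite lvl lx //; dlia. Qed.

Let bE v : d b v = (d l v - k) + (k - d l v).
Proof. by rewrite lvl lb. Qed.

Let neq u v : d l u <> d l v -> u != v.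
Proof. by move=> uv; apply/eqP => E; apply: uv; rewrite E. Qed.

Lemma branch_shape : exists z r,
  [/\ d l z = k.+1, d l r = k.+1 + d z r, 1 < d z r, k < 4 -> 2 < d z r &
      k = 2 -> 3 < d z r \/ exists2 v, d z v = (d b v).+1 & 2 < d b v].
Proof.
have [r [r1 r2]] : exists r, k.+3 <= d l r /\ (k < 4 -> k.+4 <= d l r).
  have [k4|k4] := ltnP k 4.
    by have [r] := far b; rewrite bE => br; exists r; dlia.
  by have [r] := far x; rewrite xE => xr; exists r; split=> //; dlia.
have kr : k.+1 <= d l r by dlia.
have [z [lz lrE]] := dist_point dT kr.
have bz : d b z = 1 by rewrite bE lz; dlia.
have [/eqP k2|k2] := boolP (k == 2); last first.
  exists z, r; split=> //; first dlia.
    by move=> k4; have := r2 k4; dlia.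
  by move/eqP; rewrite (negPf k2).
have k2' : k = 2 by [].
have k4 : k < 4 by dlia.
have := r2 k4 => r3.
have [v zv] := far z.
have [bv|zvE] := dist_nbr dT v bz; last first.
  by exists z, r; split=> //; try dlia; move=> _; right; exists v => //; dlia.
have lv : d l v = k + d b v by have := bE v; dlia.
exists z, v; split; try dlia; by move=> _; left.
Qed.

Lemma hole_branch : matched.
Proof.
have [z [r [lz lr zr2 zr3 k2_far]]] := branch_shape.
have [j lj zj] : exists2 j, d l j = k.+1 & z != j.
  by have [->|zj1] := eqVneq z j1; [exists j2 | exists j1].
have zr1 : 1 <= d z r by dlia.
have [t [zt zrE]] := dist_point dT zr1.
have tr1 : 1 <= d t r by dlia.
have [r3 [tr3 trE]] := dist_point dT tr1.
have lt : d l t = k.+2.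
  by have := dist_tri dT t l r; have := dist_tri dT z l t; dlia.
have lr3 : d l r3 = k.+3.
  by have := dist_tri dT r3 l r; have := dist_tri dT t l r3; dlia.
have lk i : i <= k -> exists q, d l q = i.
  by rewrite -{1}lb => ib; have [q []] := dist_point dT ib; exists q.
have [c1 lc1] := lk (k - 2) (leq_subr _ _).
have c1E v : d c1 v = (d l v - (k - 2)) + (k - 2 - d l v).
  by rewrite lvl lc1 //; dlia.
have ll := dist_refl dT l.
have c1x : c1 != x by apply: neq; dlia.
have tx : t != x by apply: neq; dlia.
have [u u_simp suf] := hole_other_simplicial (if k < 4 then l else r3).
pose y := s u.
have y_simp : simplicial h y := hole_simplicial u_simp.
have c1t : 3 < d c1 t by rewrite c1E lt; dlia.
have xy : x != y.
  apply/eqP => xy; have ux : u = x by apply: s_inj; rewrite sx xy.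
  move: u_simp; rewrite ux => /(cube_simplicialP dT)/(_ c1 t).
  rewrite !xE lc1 lt; dlia.
have y_near p q : p != x -> q != x -> d y p <= 3 -> d y q <= 3 -> d p q <= 3.
  move=> px qx yp yq; have [<-//|py] := eqVneq y p.
  have [<-|qy] := eqVneq y q; first by rewrite (dist_sym dT).
  have [<-|pq] := eqVneq p q; first by rewrite (dist_refl dT).
  have yx : y != x by rewrite eq_sym.
  have : g p q by rewrite -hx //; apply: y_simp; rewrite // hx // /cube ?py ?qy.
  by case/andP.
have y_leaf : forall p q, d y p = 1 -> d y q = 1 -> p = q.
  move=> p q0 yp yq0; apply/eqP/negPn/negP => pq0.
  have [ry yry] := far y.
  have yry3 : 3 <= d y ry by dlia.
  have [g3 [yg3 yryE]] := dist_point dT yry3.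
  have yg32 : 2 <= d y g3 by dlia.
  have [g2 [yg2 yg3E]] := dist_point dT yg32.
  have yg21 : 1 <= d y g2 by dlia.
  have [g1 [yg1 yg2E]] := dist_point dT yg21.
  have g13 : d g1 g3 = 2.
    by have := dist_tri dT g2 g1 g3; have := dist_tri dT g1 y g3; dlia.
  have g1r : d y ry = (d g1 ry).+1.
    by have := dist_tri dT g3 g1 ry; have := dist_tri dT g1 y ry; dlia.
  have {p q0 yp yq0 pq0} [q [yq qg1]] : exists q, d y q = 1 /\ q != g1.
    by have [pg|pg] := eqVneq p g1; [exists q0; rewrite -pg eq_sym | exists p].
  have qg3 : d q g3 = 4 by have := dist_two dT g3 yq yg1 qg1; dlia.
  have [qx|qx] := eqVneq q x.
    have xy1 : d x y = 1 by rewrite -qx (dist_sym dT).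
    have ly : d l y = k \/ d l y = k - 2 by have := xE y; dlia.
    case: ly => ly.
      have yb : y = b by apply: low_uniq; rewrite ly ?lb.
      have lg1 : d l g1 = k.+1.
        have : d l g1 = k.+1 \/ d l g1 = k.-1 by have := bE g1; rewrite -yb yg1; dlia.
        case=> // E; case/eqP: qg1; rewrite qx; apply: low_uniq; rewrite lx ?E //; dlia.
      have lg2 : d l g2 = k.+2.
        have := bE g2; rewrite -yb yg2; have := dist_tri dT g2 l g1.
        by have := dist_sym dT g1 g2; dlia.
      have yc1 : d y c1 <= 3 by rewrite yb bE lc1; dlia.
      have g2x : g2 != x by apply: neq; dlia.
      have := y_near c1 g2 c1x g2x yc1; rewrite yg2 c1E lg2; dlia.
    have yk : d l y <= k by dlia.
    have := lvl ry yk; have := lvl g1 yk; rewrite yg1 => yg1E yryE'.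
    have lg1 : d l g1 = k.-1 by have := dist_tri dT g1 l ry; dlia.
    by case/eqP: qg1; rewrite qx; apply: low_uniq; rewrite lx ?lg1 //; dlia.
  have [g3x|g3x] := eqVneq g3 x; last first.
    by have := y_near q g3 qx g3x; rewrite yq yg3 qg3; dlia.
  have xy3 : d x y = 3 by rewrite -g3x (dist_sym dT).
  have ly : d l y = k.+2 \/ d l y = 0 by have := xE y; dlia.
  case: ly => ly; last first.
    have yk : d l y <= k by dlia.
    have := lvl g1 yk; have := lvl q yk; rewrite yg1 yq ly => q1 g11.
    by case/eqP: qg1; apply: low_uniq; dlia.
  have yb2 : d y b = 2 by rewrite (dist_sym dT) bE ly; dlia.
  have g2b : g2 = b.
    have : d l g2 = k \/ d l g2 = k - 2.
      have g23 : d x g2 = 1 by rewrite -g3x (dist_sym dT); dlia.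
      by have := xE g2; dlia.
    case=> lg2; first by apply: low_uniq; rewrite lg2 ?lb.
    have g2k : d l g2 <= k by dlia.
    by have := lvl y g2k; have := dist_sym dT y g2; dlia.
  have g1b : d g1 b = 1 by rewrite -g2b; dlia.
  have bg1 : d b g1 = 1 by rewrite (dist_sym dT).
  have [j' [lj' j'g1]] : exists j', d l j' = k.+1 /\ g1 != j'.
    by have [gz|gz] := eqVneq g1 z; [exists j; rewrite gz | exists z].
  have bj' : d b j' = 1 by rewrite bE lj'; dlia.
  have j'x : j' != x by apply: neq; dlia.
  have g1y : d g1 y = 1 by rewrite (dist_sym dT).
  have g1q : d g1 q = 2.
    by have := dist_two dT g1 yq yg1 qg1; have := dist_sym dT q g1;
       have := dist_refl dT g1; dlia.
  have j'y : d j' y = 3.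
    by have := dist_two dT y bg1 bj' j'g1; have := dist_sym dT y b; dlia.
  have qb : d q b = 3 by have := dist_two dT b yq yg1 qg1; dlia.
  have j'q : d j' q = 4.
    by have := dist_two dT q bg1 bj' j'g1; have := dist_sym dT q b; dlia.
  have := y_near j' q j'x qx; rewrite (dist_sym dT y j') j'y yq j'q; dlia.
have two_nbrs v p q : d v p = 1 -> d v q = 1 -> p != q -> v != y.
  by move=> vp vq; apply: contra_neq => vy; apply: y_leaf; rewrite -vy.
have bz : d b z = 1 by rewrite bE lz; dlia.
have bx : d b x = 1 by rewrite bE lx; dlia.
have xz : x != z by apply: neq; dlia.
have b_y := two_nbrs b x z bx bz xz.
have by_gt1 : 1 < d b y.
  have := dist_gt0 dT b_y; rewrite leq_eqVlt => /orP[/eqP by1|//].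
  have bc1 : d b c1 = 2 by rewrite bE lc1; dlia.
  have bt : d b t = 2 by rewrite bE lt; dlia.
  have := y_near c1 t c1x tx.
  have := dist_tri dT b y c1; have := dist_tri dT b y t.
  by have := dist_sym dT y b; dlia.
have ly : k < 4 -> l != y by move=> k4; move: suf; rewrite k4 eq_sym.
have c1y : c1 != y.
  have [k2|k2] := leqP k 2.
    by have -> : c1 = l; [apply: low_uniq; rewrite lc1 ?ll; dlia | apply: ly; dlia].
  have [c2 lc2] := lk (k - 3) (leq_subr _ _).
  by apply: (two_nbrs c1 x c2); [rewrite c1E lx|rewrite c1E lc2|apply: neq]; dlia.
have r3y : r3 != y.
  have [k4|k4] := ltnP k 4; last by move: suf; rewrite ltnNge k4 eq_sym.
  have r3r : r3 != r by apply: neq; have := zr3 k4; dlia.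
  have [r4 [r34 r3E]] := dist_step dT r3r.
  have lr4 : d l r4 = k.+4.
    by have := dist_tri dT r4 l r; have := dist_tri dT r3 l r4; dlia.
  by apply: (two_nbrs r3 t r4) => //; [rewrite (dist_sym dT)|apply: neq; dlia].
have c2_ex : 2 < k -> exists2 c2, c2 != y & d l c2 = k - 3.
  move=> k2; have [c2 lc2] := lk (k - 3) (leq_subr _ _); exists c2 => //.
  have [k3|k3] := leqP k 3.
    by have -> : c2 = l; [apply: low_uniq; rewrite lc2 ?ll; dlia | apply: ly; dlia].
  have c2E v : d c2 v = (d l v - (k - 3)) + (k - 3 - d l v).
    by rewrite lvl lc2 //; dlia.
  by apply: (two_nbrs c2 c1 l); [rewrite c2E lc1|rewrite c2E ll|apply: neq]; dlia.
have branch_ex : k = 2 ->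
    (exists2 r4, r4 != y & d l r4 = k.+4 /\ d r3 r4 = 1) \/
    (exists v3 e, [/\ v3 != y, d l v3 = k.+3, d l e = k.+1, e != z & d e v3 = 2]).
  move=> k2; have k4 : k < 4 by dlia.
  have zr3' := zr3 k4.
  have r3r : r3 != r by apply: neq; dlia.
  have [r4 [r34 r3E]] := dist_step dT r3r.
  have lr4 : d l r4 = k.+4.
    by have := dist_tri dT r4 l r; have := dist_tri dT r3 l r4; dlia.
  case: (k2_far k2) => [zr4|[v zv bv]].
    left; exists r4 => //.
    have r4r : r4 != r by apply: neq; dlia.
    have [r5 [r45 r4E]] := dist_step dT r4r.
    have lr5 : d l r5 = k.+1.+4.
      by have := dist_tri dT r5 l r; have := dist_tri dT r4 l r5; dlia.
    by apply: (two_nbrs r4 r3 r5) => //; [rewrite (dist_sym dT)|apply: neq; dlia].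
  have [r4y|r4y] := eqVneq r4 y; last by left; exists r4.
  right; have lv : d l v = k + d b v by have := bE v; dlia.
  have kv : k.+3 <= d l v by dlia.
  have [v3 [lv3 lvE]] := dist_point dT kv.
  have kv3 : k.+1 <= d l v3 by dlia.
  have [e [le lv3E]] := dist_point dT kv3.
  exists v3, e; split=> //; last dlia.
    by rewrite -r4y; apply: neq; dlia.
  apply: contra_eq_neq zv => <-; have := dist_tri dT v3 e v; dlia.
have [f [f_inj fu fE]] := gh u.
have [f' fK f'K] := injF_bij f_inj.
have f'u a : (f' a == u) = (a == y) by rewrite -(inj_eq f_inj) f'K fu.
have u_leaf := simplicial_leaf dT far u_simp.
pose d1 a c := d (f' a) (f' c).
have d1A : tree_metric [set~ y] d1.
  apply: (tree_metric_pull fK f'K _ (tree_metric_sub_leaf dT u_leaf)) => a.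
  by rewrite !inE f'u.
have hE1 : {in [set~ y] &, forall a c, h a c = (a != c) && (d1 a c <= 3)}.
  move=> a c; rewrite !inE => ay cy.
  by rewrite -{1}(f'K a) -{1}(f'K c) fE ?f'u // /cube (can_eq f'K).
have hxl : l != y -> h x l.
  move=> _; apply: hole_forced => //.
  by rewrite /cube xE ll eq_sym neq ?ll ?lx /=; dlia.
apply: hole_id => v.
exact: (hole_filled dT d1A k_gt1 k_lt5 xE bE low_uniq lc1 lz lj zj lt zt lr3 tr3
  y_leaf xy c1y r3y by_gt1 hx hE1 y_simp h_sym h_irr hole_card ly hxl c2_ex
  branch_ex).
Qed.

End Branch.

End Hole.

Lemma cube_hole (V : finType) (d : V -> V -> nat) :
  tree_metric [set: V] d -> 2 < #|V| ->
  exists x, forall (h : rel V) (s : V -> V), symmetric h -> irreflexive h ->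
    injective s -> s x = x -> hypomorphism (cube d) h s ->
    (forall a b, a != x -> b != x -> h a b = cube d a b) -> matched d h.
Proof.
move=> dT V_gt2.
have [/existsP[x /forallP xP]|] := boolP [exists x, [forall v, d x v <= 3]].
  exists x => h s h_sym h_irr s_inj sx gh hx.
  exact: (hole_universal dT h_sym h_irr s_inj sx gh hx V_gt2 xP).
rewrite negb_exists => /forallP far'.
have far v : exists r, 3 < d v r.
  by have := far' v; rewrite negb_forall => /existsP[r]; rewrite -ltnNge; exists r.
have [v0 _] : exists v0 : V, v0 \in V by apply/card_gt0P; apply: leq_trans V_gt2.
pose simp v := [forall a, forall b, [&& cube d v a, cube d v b & a != b] ==> cube d a b].
have simpP v : reflect (simplicial (cube d) v) (simp v).
  apply: (iffP forallP) => [sv a b va vb ab | sv a].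
    by have := forallP (sv a) b; rewrite va vb ab.
  by apply/forallP=> b; apply/implyP=> /and3P[]; apply: sv.
have [m m_far] := ex_farthest d v0.
have [l /simpP l_simp l_min'] :=
  @arg_minnP _ m simp (degree (cube d)) (introT (simpP m) (farthest_simplicial dT m_far)).
have l_min u : simplicial (cube d) u -> degree (cube d) l <= degree (cube d) u.
  by move/simpP; apply: l_min'.
have ll := dist_refl dT l.
have [r lr] := far l.
pose two i := [exists u, exists v, [&& d l u == i, d l v == i & u != v]].
have uniqP k : (forall i, i <= k -> ~~ two i) ->
    forall u v, d l u = d l v -> d l u <= k -> u = v.
  move=> no2 u v uv uk; apply/eqP/negPn/negP => nuv; case/negP: (no2 _ uk).
  by apply/existsP; exists u; apply/existsP; exists v; rewrite uv eqxx.
have leaf := simplicial_leaf dT far l_simp.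
have no01 i : i <= 1 -> ~~ two i.
  move=> i1; apply/existsP=> -[u /existsP[v /and3P[/eqP lu /eqP lv]]].
  move: lu lv i1; case: i => [|[|//]] lu lv _; last by rewrite (leaf u v) ?eqxx.
  by rewrite -(dist_eq dT lu) -(dist_eq dT lv) eqxx.
have lr1 : 1 <= d l r by dlia.
have [p [lp lrE]] := dist_point dT lr1.
have [two5|no_two5] := boolP [exists i : 'I_6, two i]; last first.
  have no2 i : i <= 5 -> ~~ two i.
    move=> i5; move: no_two5; rewrite negb_exists.
    by move/forallP/(_ (Ordinal (i5 : i < 6))).
  exists p => h s h_sym h_irr s_inj sx gh hx.
  exact: (hole_path dT h_sym h_irr s_inj sx gh hx V_gt2 far l_simp l_min lp
    (uniqP _ no2)).
have ex2 : exists i, two i by case/existsP: two5 => i two_i; exists (nat_of_ord i).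
case: (ex_minnP ex2) => i i_two i_min.
have i6 : i < 6 by case/existsP: two5 => j /i_min ij; apply: leq_ltn_trans ij (ltn_ord j).
have no2 j : j < i -> ~~ two j.
  by move=> ji; apply/negP => /i_min; rewrite leqNgt ji.
have i2 : 2 <= i by rewrite leqNgt; apply/negP => /no01; rewrite i_two.
have /existsP[u /existsP[v /and3P[/eqP lu /eqP lv uv]]] := i_two.
have lu' : d l u = i by [].
have lv' : d l v = i by [].
have [/eqP iE|i2'] := boolP (i == 2).
  exists l => h s h_sym h_irr s_inj sx gh hx.
  by apply: (hole_twin dT h_sym h_irr s_inj sx gh hx V_gt2 far l_simp l_min _ _ uv);
    rewrite ?lu ?lv.
have i3 : 2 < i by rewrite ltn_neqAle eq_sym i2'.
have [k ik] : exists k, i = k.+1 by exists i.-1; dlia.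
have kb : k <= d l u by dlia.
have kx : k.-1 <= d l u by dlia.
have [b [lb _]] := dist_point dT kb.
have [x [lx _]] := dist_point dT kx.
have low : forall u v, d l u = d l v -> d l u <= k -> u = v.
  by apply: uniqP => j jk; apply: no2; rewrite ik.
exists x => h s h_sym h_irr s_inj sx gh hx.
apply: (hole_branch dT h_sym h_irr s_inj sx gh hx V_gt2 far l_simp l_min
  _ _ low lx lb _ _ uv).
- by dlia.
- by dlia.
- by rewrite lu' ik.
- by rewrite lv' ik.
Qed.

Lemma same_deck_iso G G' H : graph_iso G G' -> same_deck H G -> same_deck H G'.
Proof.
case=> f f_bij f_adj deckHG K; rewrite deckHG /deck -[RHS](on_card_preimset (f := f)).
  apply: eq_card => v; rewrite !inE.
  have iso_v := card_iso_map f_bij f_adj v.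
  apply/graph_isobP/graph_isobP => vK; last exact: graph_iso_trans iso_v vK.
  exact: graph_iso_trans (graph_iso_sym iso_v) vK.
exact: onW_bij.
Qed.

Theorem theorem4p1 (G : sgraph) (hG : 3 <= #|G|)
    (hcube : exists2 T : sgraph, is_tree T & graph_iso G (graph_power T 3))
    (H : sgraph) (hdeck : same_deck H G) : graph_iso H G.
Proof.
case: hcube => T treeT isoG; apply: graph_iso_trans (graph_iso_sym isoG).
have deckHT := same_deck_iso isoG hdeck.
have [d dT dE] := tree_cube_metric treeT.
have T_gt2 : 2 < #|T| by case: isoG => f f_bij _; rewrite -(bij_eq_card f_bij).
have [x xP] := cube_hole dT T_gt2.
have [h [s [[h_sym h_irr s_inj] sx gh hx [F F_bij FE]]]] :=
  same_deck_hypomorphism (G := graph_power T 3) x deckHT.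
have [p p_inj pE] : matched d h.
  apply: (xP h s) => // [v | a b ax bx]; last by rewrite hx //= dE.
  have [f [f_inj fv fE]] := gh v; exists f; split=> // a b av bv.
  by rewrite fE //= dE.
apply: graph_iso_sym; exists (F \o p).
  exact: bij_comp F_bij (injF_bij p_inj).
by move=> a b; rewrite /= FE pE dE.
Qed.
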